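(* Let $G$ be a locally compact group that has a compact open subgroup. Let $\mathcal P(G)$ be the space of polynomial functions in $C_c(G)$ and consider $C_c(G)$ as a $^*$-algebra with pointwise product and involution $f\mapsto\overline f$ (the function algebra). Then $\mathcal P(G)$ is a non-degenerate $^*$-subalgebra of $C_c(G)$, and it separates the points of $G$. For each compact subset $C$ of $G$ there is a function $f\in\mathcal P(G)$ such that $f(p)=1$ for all $p\in C$. Consequently the function algebra $C_c(G)$ has local units in the subalgebra $\mathcal P(G)$, and the product in the algebra $\mathcal P(G)$ is non-degenerate.
   Context: Locally compact groups are Hausdorff. $C_c(G)$ is the space of continuous complex functions on $G$ with compact support. For $f\in C_c(G)$ and $q\in G$, let $(q\cdot f)(p)=f(pq)$. A function $f\in C_c(G)$ is polynomial if there are an open neighborhood $V$ of the identity in $G$ and a finite-dimensional subspace $F$ of $C_c(G)$ such that $v\cdot f\in F$ for all $v\in V$. A (sub)algebra $A$ is non-degenerate (its product is non-degenerate) if $a\in A$ and $ab=0$ for all $b\in A$ imply $a=0$, and likewise $ba=0$ for all $b\in A$ implies $a=0$. An algebra $B$ has local units in a subalgebra $A$ if for any finitely many $b_1,\dots,b_n\in B$ there is $u\in A$ with $ub_i=b_iu=b_i$ for all $i$. *)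

(* Defs.v *)
From HB Require Import structures.
From mathcomp Require Import all_boot all_order all_algebra complex.
From mathcomp Require Import all_classical all_reals all_analysis.
Import Order.TTheory GRing.Theory Num.Theory.
Import numFieldNormedType.Exports.

Set Implicit Arguments.
Unset Strict Implicit.
Unset Printing Implicit Defensive.

Local Open Scope classical_set_scope.
Local Open Scope ring_scope.

(* Typed as a numClosedFieldType so that R[i] gets the topology of its norm. *)
Definition Cplx (R : realType) : numClosedFieldType := R[i].

HB.structure Definition PreTopologicalGroup := {G of Topological G & Group G}.

HB.mixin Record PreTopologicalGroup_isTopologicalGroup G
    of PreTopologicalGroup G := {
  mulg_continuous : continuous (fun x : G * G => (x.1 * x.2)%g) ;
  invg_continuous : continuous (fun x : G => (x^-1)%g)
}.

#[short(type="topologicalGroupType")]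
HB.structure Definition TopologicalGroup :=
  {G of PreTopologicalGroup G & PreTopologicalGroup_isTopologicalGroup G}.

Definition locally_compact_group (G : topologicalGroupType) : Prop :=
  hausdorff_space G /\ locally_compact [set: G].

Definition subgroup (G : groupType) (H : set G) : Prop := group_closed [in H].

Definition has_compact_open_subgroup (G : topologicalGroupType) : Prop :=
  exists H : set G, [/\ subgroup H, compact H & open H].

Section LinearAlgebra.
Context {K : pzRingType} {V : lmodType K}.
Implicit Types F : set V.

Definition linear_subspace F : Prop :=
  [/\ F 0, (forall x y, F x -> F y -> F (x + y))
    & (forall (a : K) x, F x -> F (a *: x))].

Definition lin_span n (b : 'I_n -> V) : set V :=
  [set \sum_(i < n) c i *: b i | c in [set: 'I_n -> K]].

Definition finite_dim_subspace F : Prop :=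
  linear_subspace F /\ exists n (b : 'I_n -> V), F = lin_span b.

End LinearAlgebra.

(* Algebras without unit are represented as sets of elements of an ambient ring,
   whose product they inherit. *)
Section Nonunital.
Context {V : pzRingType}.
Implicit Types A B : set V.

Definition nondegenerate_product A : Prop :=
  (forall a, A a -> (forall b, A b -> a * b = 0) -> a = 0) /\
  (forall a, A a -> (forall b, A b -> b * a = 0) -> a = 0).

Definition local_units_in B A : Prop :=
  forall n (b : 'I_n -> V), (forall i, B (b i)) ->
    exists2 u, A u & forall i, u * b i = b i /\ b i * u = b i.

End Nonunital.

Section FunctionAlgebra.
Context {R : realType} {T : Type}.
Implicit Types A B : set (T -> Cplx R).

Definition star (f : T -> Cplx R) : T -> Cplx R := fun p => (f p)^*.

(* [f * g] and [a *: f] are pointwise. *)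
Definition star_subalgebra A B : Prop :=
  [/\ A `<=` B, linear_subspace A,
      (forall f g, A f -> A g -> A (f * g))
    & (forall f, A f -> A (star f))].

Definition separates_points A : Prop :=
  forall p q : T, p <> q -> exists2 f, A f & f p <> f q.

End FunctionAlgebra.

Section PolynomialFunctions.
Context (R : realType) (G : topologicalGroupType).

Definition Cc : set (G -> Cplx R) :=
  [set f : G -> Cplx R | continuous f /\ compact (closure [set p : G | f p != 0 :> Cplx R])].

Definition translate (q : G) (f : G -> Cplx R) : G -> Cplx R :=
  fun p => f (p * q)%g.

Definition polynomial_functions : set (G -> Cplx R) :=
  [set f | Cc f /\
    exists (V : set G) (F : set (G -> Cplx R)),
      [/\ open V, V 1%g, finite_dim_subspace F, F `<=` Cc
        & forall v, V v -> F (translate v f)]].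

End PolynomialFunctions.

Arguments Cc : clear implicits.
Arguments polynomial_functions : clear implicits.

Lemma Cc_star_algebra (R : realType) (G : topologicalGroupType) :
  star_subalgebra (Cc R G) setT.
Proof.
split => //.
- split.
  + split; first by move=> x; exact: cst_continuous.
    rewrite (_ : [set _ | _] = set0) ?closure0; first exact: compact0.
    by rewrite -subset0 => p /=; rewrite eqxx.
  + move=> f g [cf kf] [cg kg]; split.
      by move=> x; apply: cvgD; [exact: cf|exact: cg].
    apply: (subclosed_compact (@closed_closure _ _) (compactU kf kg)).
    rewrite -closureU; apply: closureS => p /=.
    have [fp|] := eqVneq (f p) 0; last by left.
    by rewrite fctE fp add0r; right.
  + move=> a f [cf kf]; split.
      by move=> x; apply: cvgZl_tmp; exact: cf.
    apply: (subclosed_compact (@closed_closure _ _) kf).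
    apply: closureS => p /=; apply: contra_neq => fp.
    rewrite [LHS]/(a * f p) fp; exact: (@mulr0 (Cplx R)).
- move=> f g [cf kf] [cg kg]; split.
    by move=> x; apply: cvgM; [exact: cf|exact: cg].
  apply: (subclosed_compact (@closed_closure _ _) kf).
  apply: closureS => p /=; apply: contra_neq => fp.
  rewrite [LHS]/(f p * g p) fp; exact: (@mul0r (Cplx R)).
- move=> f [cf kf]; split.
    move=> x; apply/cvgrPdist_lt => e e0.
    near=> y; rewrite /star -rmorphB norm_conjC.
    near: y; move: e e0; apply/cvgrPdist_lt; exact: cf.
  apply: (subclosed_compact (@closed_closure _ _) kf).
  by apply: closureS => p /=; rewrite /star conjC_eq0.
Unshelve. all: by end_near.
Qed.

(* Main.v *)
From HB Require Import structures.
Require Import Defs.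
From mathcomp Require Import all_boot all_order all_algebra complex.
From mathcomp Require Import all_classical all_reals all_analysis.
From mathcomp Require Import ring lra.
Import Order.TTheory GRing.Theory Num.Theory.
Import numFieldNormedType.Exports.
Set Implicit Arguments.
Unset Strict Implicit.
Unset Printing Implicit Defensive.
Local Open Scope classical_set_scope.
Local Open Scope ring_scope.

(** Let [H] be a compact open subgroup of [G].  The indicator function of a finite
    union of left cosets [xH] is invariant under right translation by [H], hence
    locally constant and polynomial.  Finitely many cosets cover a given compact
    set, so some polynomial function is 1 on that set; applied to a set containing
    the supports of finitely many functions this gives local units, and local units
    inside the algebra make its product non-degenerate.  Sums, products and
    conjugates of polynomial functions are polynomial because the sums, products
    and conjugates of two finite spanning families span the new translates.

    What remains is to separate [p] from [q].  If [pH] and [qH] differ, an indicator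
    does it.  Otherwise [h = p^-1 q] is a nontrivial element of the compact group
    [H], and what is needed is a continuous function on [H] whose right translates
    span a finite-dimensional space and which takes different values at [h] and 1;
    extended by zero and moved to [pH] it is polynomial on [G].  This is the
    Peter-Weyl theorem ([exists_representative_function]).  It is proved here for
    real functions on a compact group [K], with neither Haar measure nor the
    spectral theorem for compact operators.

    The invariant integral is von Neumann's mean.  By uniform continuity and
    compactness, averaging finitely many right translates of a continuous [f] can be
    made to shrink the oscillation of [f] by a fixed factor as long as it is not
    small ([oscillation_shrinks]), so suitable averages of right translates are
    nearly constant; likewise for left translates.  Right and left averaging commute,
    so all these constants have a common limit, [mean f].  It is linear, positive,
    faithful, invariant, and satisfies Fubini's theorem.  Convolution
    with respect to it is associative, and [conv v] commutes with right translations.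

    Let [w] be continuous, symmetric and nonzero.  Its eigenfunction for the
    dominant eigenvalue is found by power iteration.  Put [A n = w^(2n+2) (1)], the
    trace of a power of the positive operator [conv (conv w w)].  Then [A] is
    log-convex and submultiplicative, so with [l = lim A (n+1) / A n] the numbers
    [b n = A n / l^(n+1)] do not increase and are at least 1 ([growth_rate]).  Since the
    inner products of the functions [h n = w^(2n+2) / l^(n+1)] are terms of the convergent
    sequence [b], the sequence [h] is Cauchy in the L2 norm; convolution by a
    continuous function turns this into uniform convergence, and the limit [e]
    satisfies [conv (conv w w) e = l e] and is not orthogonal to [conv w w]
    ([dominant_eigenfunction]).  Bessel's inequality bounds the number of orthonormal
    functions in an eigenspace, so eigenspaces are finite-dimensional
    ([eigenspace_finite_dim]); being invariant under right translations, they consist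
    of functions whose translates span a finite-dimensional space.

    To separate [p] from 1 in [K], choose by Urysohn's lemma a continuous [k] with
    [k p <> k 1], put [D x = k x - k (x p)] and let [w] be the convolution of
    [x |-> D (x^-1)] with [D].  If the eigenfunction [e] obtained from [w] were
    invariant under right translation by [p], its convolution with [x |-> D (x^-1)]
    would vanish, hence also that with [conv w w], and [e] would be orthogonal to
    [conv w w].
    So [e (x p) <> e x] for some [x], and the left translate of [e] by [x] separates
    [p] from 1. *)

(** * A subgroup as a topological group *)

(** The proof [sH] is a parameter of the type so that the group structure below,
    which depends on it, can be inferred from the type. *)
Definition subgroup_type (G : groupType) (H : set G) (sH : subgroup H) : Type :=
  set_type H.

Section SubgroupType.
Context (G : topologicalGroupType) (H : set G) (sH : subgroup H).
Local Notation K := (subgroup_type sH).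

HB.instance Definition _ := SubChoice.on K.
HB.instance Definition _ := Topological.copy K (set_type H).
HB.instance Definition _ := SubChoice_isSubGroup.Build G [in H] K sH.

Lemma subgroup_val_continuous : continuous (val : K -> G).
Proof. exact: initial_continuous. Qed.

Lemma continuous_to_subgroup (T : topologicalType) (t : T) (f : T -> K) :
  {for t, continuous (fun x => val (f x))} -> {for t, continuous f}.
Proof.
move=> cf U [_ [[W oW <-] Wft WU]].
have /cf : nbhs (val (f t)) W by apply: open_nbhs_nbhs.
rewrite !nbhs_simpl /=; apply: filterS => x Wx.
exact: WU.
Qed.

Let subgroup_mulg_continuous : continuous (fun x : K * K => (x.1 * x.2)%g).
Proof.
move=> [x y]; apply: continuous_to_subgroup.
have -> : (fun u : K * K => val (u.1 * u.2)%g) =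
    (fun u : G * G => (u.1 * u.2)%g) \o (fun u : K * K => (val u.1, val u.2)).
  by apply/funext => u; exact: valM.
apply: continuous_comp; last exact: mulg_continuous.
apply: cvg_pair.
  by apply: continuous_comp; [exact: cvg_fst | exact: subgroup_val_continuous].
by apply: continuous_comp; [exact: cvg_snd | exact: subgroup_val_continuous].
Qed.

Let subgroup_invg_continuous : continuous (fun x : K => (x^-1)%g).
Proof.
move=> x; apply: continuous_to_subgroup.
have -> : (fun u : K => val (u^-1)%g) = (fun u : G => (u^-1)%g) \o val.
  by apply/funext => u; exact: gmulfV.
apply: continuous_comp; first exact: subgroup_val_continuous.
exact: invg_continuous.
Qed.

HB.instance Definition _ :=
  PreTopologicalGroup_isTopologicalGroup.Build K
    subgroup_mulg_continuous subgroup_invg_continuous.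

(** The covering form of compactness transfers along [val] because every property
    of [u : K] can be read as a property of the point [val u] of [H]. *)
Lemma subgroup_compact : compact H -> compact [set: K].
Proof.
move=> cH; apply/compact_near_coveringP => I F P FF cov.
have cH' : \near F, H `<=` (fun x => forall u : K, val u = x -> P F u).
  move/compact_near_coveringP : cH; apply => x Hx.
  have [u ux] : exists u : K, val u = x by exists (Sub x (mem_set Hx)); rewrite SubK.
  have [[A B] /= [[_ [[W oW <-] Wu WA]] FB AB]] := cov u Logic.I.
  exists (W, B).
    by split=> //=; apply: open_nbhs_nbhs; rewrite -ux.
  case=> y i /= [Wy Bi] v vy; apply: (AB (v, i)); split=> //=; apply: WA.
  by move: Wy; rewrite -vy.
apply: filterS cH' => i Hi u _; exact: (Hi (val u) (set_mem (valP u)) u erefl).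
Qed.

Lemma subgroup_hausdorff : hausdorff_space G -> hausdorff_space K.
Proof.
move=> hG u v uv; apply/val_inj/hG => A B Au Bv.
have nA := subgroup_val_continuous Au.
have nB := subgroup_val_continuous Bv.
by have [w [Aw Bw]] := uv _ _ nA nB; exists (val w).
Qed.
End SubgroupType.

(** * Finite averages, continuity and compactness *)

Section Avg.
Context {R : realType}.

(** Uniform weights are enough: a repeated entry counts as a larger weight, and
    composing two uniform averages of translates gives a uniform average over the
    products of the entries ([avg_allpairs]). *)
Definition avg (I : Type) (s : seq I) (phi : I -> R) : R :=
  (size s)%:R^-1 * \sum_(a <- s) phi a.

Lemma eq_avg (I : Type) (s : seq I) phi psi : phi =1 psi -> avg s phi = avg s psi.
Proof. by move=> e; rewrite /avg; congr (_ * _); apply: eq_bigr => a _. Qed.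

Lemma avgD (I : Type) (s : seq I) phi psi :
  avg s (fun a => phi a + psi a) = avg s phi + avg s psi.
Proof. by rewrite /avg big_split mulrDr. Qed.

Lemma avgZ (I : Type) (s : seq I) c phi :
  avg s (fun a => c * phi a) = c * avg s phi.
Proof. by rewrite /avg -mulr_sumr mulrCA. Qed.

Lemma avg_cst (I : Type) (s : seq I) c : (0 < size s)%N -> avg s (fun=> c) = c.
Proof.
move=> s0; rewrite /avg big_const_seq count_predT iter_addr_0 -[c *+ _]mulr_natl.
by rewrite mulKf // pnatr_eq0 -lt0n.
Qed.

Lemma ler_avg (I : eqType) (s : seq I) phi psi :
  (forall a, a \in s -> phi a <= psi a) -> avg s phi <= avg s psi.
Proof.
move=> le; rewrite /avg ler_wpM2l ?invr_ge0 ?ler0n //.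
by rewrite big_seq [leRHS]big_seq; apply: ler_sum.
Qed.

Lemma avg_le (I : eqType) (s : seq I) phi c : (0 < size s)%N ->
  (forall a, phi a <= c) -> avg s phi <= c.
Proof. by move=> s0 le; rewrite -[leRHS](avg_cst c s0); apply: ler_avg. Qed.

Lemma avg_ge (I : eqType) (s : seq I) phi c : (0 < size s)%N ->
  (forall a, c <= phi a) -> c <= avg s phi.
Proof. by move=> s0 le; rewrite -[leLHS](avg_cst c s0); apply: ler_avg. Qed.

Lemma avg_dist (I : eqType) (s : seq I) phi c e : (0 < size s)%N ->
  (forall a, `|phi a - c| <= e) -> `|avg s phi - c| <= e.
Proof.
move=> s0 le; rewrite ler_distl; apply/andP; split.
  by apply: avg_ge => // a; have := le a; rewrite ler_distl => /andP[].
by apply: avg_le => // a; have := le a; rewrite ler_distl => /andP[].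
Qed.

Lemma avg_exchange (I J : Type) (s : seq I) (t : seq J) phi :
  avg s (fun a => avg t (phi a)) = avg t (fun b => avg s (phi^~ b)).
Proof.
rewrite /avg -!mulr_sumr exchange_big; rewrite !mulrA; congr (_ * _).
exact: mulrC.
Qed.

Lemma avg_allpairs (I J L : Type) (h : I -> J -> L) (s : seq I) (t : seq J) phi :
  avg [seq h a b | a <- s, b <- t] phi = avg s (fun a => avg t (fun b => phi (h a b))).
Proof.
rewrite /avg size_allpairs big_allpairs_dep natrM invfM -!mulr_sumr mulrA.
by [].
Qed.

Lemma avg_map (I J : Type) (h : I -> J) (s : seq I) phi :
  avg [seq h a | a <- s] phi = avg s (fun a => phi (h a)).
Proof. by rewrite /avg size_map big_map. Qed.

Lemma avg_le_one (I : eqType) (s : seq I) phi c d b : b \in s ->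
  (forall a, phi a <= c) -> phi b <= c - d -> avg s phi <= c - d / (size s)%:R.
Proof.
move=> bs le leb; have s0 : (0 < size s)%N by case: s bs.
have -> : c - d / (size s)%:R = (size s)%:R^-1 * ((size s)%:R * c - d).
  by field; rewrite pnatr_eq0 -lt0n.
rewrite /avg ler_wpM2l ?invr_ge0 ?ler0n // (big_rem b) //=.
have -> : (size s)%:R * c - d = (c - d) + c *+ (size s).-1.
  by rewrite -mulr_natl -(prednK s0) /= -natr1; ring.
apply: lerD => //; rewrite -(size_rem bs) -[_ *+ _]addr0 -iter_addr -count_predT.
by rewrite -big_const_seq; apply: ler_sum.
Qed.

End Avg.

Lemma eq_of_dist_le (R : realType) (x y : R) :
  (forall e, 0 < e -> `|x - y| <= e) -> x = y.
Proof.
move=> h; apply/eqP; rewrite -subr_eq0 -normr_eq0 eq_le normr_ge0 andbT.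
by apply/ler_addgt0Pr => e e0; rewrite add0r h.
Qed.

Section Cts.
Context {X Y Z : topologicalType}.

Lemma cts_comp (f : Y -> Z) (g : X -> Y) :
  continuous f -> continuous g -> continuous (fun x => f (g x)).
Proof. by move=> cf cg x; apply: continuous_comp; [exact: cg|exact: cf]. Qed.

Lemma cts_pair (f : X -> Y) (g : X -> Z) :
  continuous f -> continuous g -> continuous (fun x => (f x, g x)).
Proof. by move=> cf cg x; apply: cvg_pair; [exact: cf|exact: cg]. Qed.

Lemma cts_id : continuous (fun x : X => x).
Proof. by move=> x; exact: cvg_id. Qed.

Lemma cts_cst (y : Y) : continuous (fun _ : X => y).
Proof. by move=> x; exact: cvg_cst. Qed.

End Cts.

Lemma cts_fst {X Y : topologicalType} : continuous (fun x : X * Y => x.1).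
Proof. by move=> x; exact: cvg_fst. Qed.

Lemma cts_snd {X Y : topologicalType} : continuous (fun x : X * Y => x.2).
Proof. by move=> x; exact: cvg_snd. Qed.

Lemma cts_mulg {X : topologicalType} {G : topologicalGroupType} (f g : X -> G) :
  continuous f -> continuous g -> continuous (fun x => f x * g x)%g.
Proof.
move=> cf cg; apply: (@cts_comp _ _ _ (fun u : G * G => (u.1 * u.2)%g)
                        (fun x => (f x, g x))).
  exact: mulg_continuous.
exact: cts_pair.
Qed.

Lemma cts_invg {X : topologicalType} {G : topologicalGroupType} (f : X -> G) :
  continuous f -> continuous (fun x => (f x)^-1)%g.
Proof.
move=> cf; apply: (@cts_comp _ _ _ (fun u => u^-1)%g f) => //.
exact: invg_continuous.
Qed.

Section CtsR.
Context {R : realType} {X : topologicalType}.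
Implicit Types f g : X -> R.

Lemma cts_add f g : continuous f -> continuous g -> continuous (fun x => f x + g x).
Proof. by move=> cf cg x; apply: cvgD; [exact: cf|exact: cg]. Qed.

Lemma cts_opp f : continuous f -> continuous (fun x => - f x).
Proof. by move=> cf x; apply: cvgN; exact: cf. Qed.

Lemma cts_mul f g : continuous f -> continuous g -> continuous (fun x => f x * g x).
Proof. by move=> cf cg x; apply: cvgM; [exact: cf|exact: cg]. Qed.

Lemma cts_exp f n : continuous f -> continuous (fun x => f x ^+ n).
Proof.
move=> cf; elim: n => [|n ih]; first exact: cts_cst.
by under eq_fun do rewrite exprS; exact: cts_mul.
Qed.

Lemma cts_sum (I : Type) (s : seq I) (f : I -> X -> R) :
  (forall i, continuous (f i)) -> continuous (fun x => \sum_(i <- s) f i x).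
Proof.
move=> cf; elim: s => [|i s ih].
  under eq_fun do rewrite big_nil.
  exact: cts_cst.
under eq_fun do rewrite big_cons.
exact: cts_add.
Qed.

End CtsR.

(** Proves continuity of an expression by following its syntax; a head function
    that is not an operation must be known continuous from the context. *)
Ltac cts1 := lazymatch goal with
  | |- continuous (fun x => x) => exact: cts_id
  | |- continuous (fun _ => ?y) => exact: cts_cst
  | |- continuous (fun x => (@?f x) + (@?g x)) => apply: (@cts_add _ _ f g)
  | |- continuous (fun x => (@?f x) * (@?g x)) => apply: (@cts_mul _ _ f g)
  | |- continuous (fun x => - (@?f x)) => apply: (@cts_opp _ _ f)
  | |- continuous (fun x => (@?f x) ^+ ?n) => apply: (@cts_exp _ _ f n)
  | |- continuous (fun x => ((@?f x) * (@?g x))%g) => apply: (@cts_mulg _ _ f g)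
  | |- continuous (fun x => ((@?f x)^-1)%g) => apply: (@cts_invg _ _ f)
  | |- continuous (fun x => (@?f x, @?g x)) => apply: (@cts_pair _ _ _ f g)
  | |- continuous (fun x => x.1) => exact: cts_fst
  | |- continuous (fun x => x.2) => exact: cts_snd
  | H : continuous ?f |- continuous ?f => exact H
  | H : continuous ?f |- continuous (fun x => ?f x) => exact H
  | H : continuous ?f |- continuous (fun x => ?f (@?h x)) =>
       apply: (@cts_comp _ _ _ f h)
  | H : forall i, continuous (?f i) |- continuous (?f ?i) => exact (H i)
  | H : forall i, continuous (?f i) |- continuous (fun x => ?f ?i x) => exact (H i)
  | H : forall i, continuous (?f i) |- continuous (fun x => ?f ?i (@?h x)) =>
       apply: (@cts_comp _ _ _ (f i) h (H i))
  end.
Ltac cts := repeat cts1.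

(** Finite subcovers without a base point: the property of being covered by the
    members of [F] holds eventually along the filter of large sequences. *)
Lemma compact_cover_seq (I : eqType) (X : topologicalType) (A : set X) (f : I -> set X) :
  compact A -> (forall x, A x -> exists i, nbhs x (f i)) ->
  exists s : seq I, forall x, A x -> exists2 i, i \in s & f i x.
Proof.
move=> /compact_near_coveringP cA cov.
(* A set of sequences is large when it contains all those with given entries. *)
pose F : set_system (seq I) :=
  filter_from [set: seq I] (fun s => [set t : seq I | {subset s <= t}]).
have FF : Filter F.
  apply: filter_from_filter; first by exists [::].
  move=> s t _ _; exists (s ++ t) => // u /= st; split => i ist; apply: st;
  by rewrite mem_cat ist ?orbT.
have : \near F, A `<=` (fun x => exists2 i, i \in F & f i x).
  apply: cA => x Ax; have [i xi] := cov x Ax.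
  exists (f i, [set t : seq I | {subset [:: i] <= t}]) => /=.
    by split=> //; exists [:: i].
  by case=> y t /= [fy it]; exists i => //; apply: it; rewrite mem_head.
case=> s _ sP; exists s => x Ax; exact: (sP s).
Qed.

Section Compact.
Context {R : realType} {K : topologicalGroupType} (cK : compact [set: K]).

(** The number of translates depends on [U] only; this uniformity is what makes
    [oscillation_shrinks] work for all averages of a function at once. *)
Lemma translates_cover (U : set K) : nbhs 1%g U ->
  exists2 s : seq K, (0 < size s)%N & forall x, exists2 a, a \in s & U (x * a)%g.
Proof.
move=> U1; have [|s sP] := @compact_cover_seq K K setT (fun a x => U (x * a)%g) cK.
  move=> x _; exists x^-1%g.
  have c : continuous (fun y : K => (y * x^-1)%g) by cts.
  by have := c x U; rewrite /= mulgV; apply.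
exists s => [|x]; last exact: sP.
by have [] := sP 1%g Logic.I; case: s {sP}.
Qed.

(** Compactness of [K] makes continuity in the parameter uniform over [K]. *)
Lemma near_parameter_unif (X : topologicalType) (F : X * K -> R) (x : X) e :
  continuous F -> 0 < e -> \forall x' \near x, forall y, `|F (x', y) - F (x, y)| < e.
Proof.
move=> cF e0; move/compact_near_coveringP : cK => cK'.
have : \forall x' \near x, [set: K] `<=` (fun y => `|F (x', y) - F (x, y)| < e).
  apply: cK' => y _.
  pose D (u : K * X) := `|F (u.2, u.1) - F (x, u.1)|.
  have cD : continuous D.
    apply: (@cts_comp _ _ _ (fun r : R => `|r|)
      (fun u : K * X => F (u.2, u.1) - F (x, u.1))); first exact: norm_continuous.
    by cts.
  have := cD (y, x) [set r | r < e]; apply.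
  apply: open_nbhs_nbhs; split; first exact: open_lt.
  by rewrite /D /= subrr normr0.
by apply: filterS => x' h y; exact: h.
Qed.

Lemma compact_bounded_fun (f : K -> R) : continuous f -> exists c, forall x, `|f x| <= c.
Proof.
move=> cf.
have : compact (f @` setT) by apply: continuous_compact => //; apply: continuous_subspaceT.
move=> /compact_bounded [M [_ Mf]]; exists (M + 1) => x.
by apply: (Mf (M + 1)); [rewrite ltrDl | exists x].
Qed.
End Compact.

(** * The invariant mean of a compact group *)

Section Mean.
Context {R : realType} {K : topologicalGroupType} (cK : compact [set: K]).
Implicit Types (f g : K -> R) (s t : seq K).

(** A one-sided definition, so that no limit has to exist beforehand; that every
    nearly constant average, right or left, is close to this number is shown in
    [mean_near_right] and [mean_near_left]. *)
Definition mean f : R :=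
  sup [set m | exists2 s, (0 < size s)%N & forall x, m <= avg s (fun a => f (x * a)%g)].

Lemma unif_cts_left f e : continuous f -> 0 < e ->
  \forall u \near (1%g : K), forall x, `|f (u * x)%g - f x| < e.
Proof.
move=> cf e0.
have cF : continuous (fun z : K * K => f (z.1 * z.2)%g) by cts.
have := near_parameter_unif cK 1%g cF e0.
by apply: filterS => u h x; have := h x; rewrite /= mul1g.
Qed.

(** An average [g] of right translates of [f] has the same modulus of left uniform
    continuity as [f].  If [g] is low at [x0], it is therefore rather low on [U * x0]
    with [U] depending on [f] and [e] only; if [N] right translates of [U] cover [K],
    averaging [N] more right translates of [g] brings in a low value at every point.
    Hence [N] is the same for all averages of [f] that oscillate by at least [e]. *)
Lemma oscillation_shrinks f e : continuous f -> 0 < e ->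
  exists2 N : R, 1 <= N & forall s m d, (0 < size s)%N -> e <= d ->
    (forall x, m <= avg s (fun a => f (x * a)%g) <= m + d) ->
  exists s' m', (0 < size s')%N /\
    forall x, m' <= avg s' (fun a => f (x * a)%g) <= m' + d * (1 - (4 * N)^-1).
Proof.
move=> cf e0.
have e4 : 0 < e / 4 by lra.
have nU := unif_cts_left cf e4.
have [t t0 tU] := translates_cover cK nU.
have N1 : 1 <= (size t)%:R :> R by rewrite ler1n.
exists (size t)%:R => // s m d s0 ed osc.
pose g x := avg s (fun a => f (x * a)%g).
set q := (4 * _)^-1.
have q4 : q <= 4^-1 by rewrite /q lef_pV2 ?posrE; lra.
have dq : d / 2 / (size t)%:R = 2 * (d * q).
  by rewrite /q; field; rewrite pnatr_eq0 -lt0n.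
have dq4 : d * q <= d / 4 by rewrite ler_wpM2l //; lra.
have dq0 : 0 <= d * q by rewrite mulr_ge0 ?invr_ge0; lra.
(* If [g] is nowhere in the lowest quarter of the range, the lower bound [m] can be
   raised by [d / 4]; otherwise the averaging argument applies. *)
have [[x0 gx0]|nox] := pselect (exists x0, g x0 <= m + d / 4); last first.
  exists s, (m + d / 4); split=> // x.
  have [_ gM] := andP (osc x).
  have : m + d / 4 < g x by rewrite ltNge; apply/negP => gx; apply: nox; exists x.
  rewrite -/(g x) in gM *; move=> /ltW -> /=; lra.
exists [seq (c * x0 * a)%g | c <- t, a <- s], m; split.
  by rewrite size_allpairs muln_gt0 t0.
move=> x; rewrite avg_allpairs.
have -> : avg t (fun c => avg s (fun a => f (x * (c * x0 * a))%g)) =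
    avg t (fun c => g (x * c * x0)%g).
  by apply: eq_avg => c; apply: eq_avg => a; rewrite !mulgA.
apply/andP; split; first by apply: avg_ge => // c; have /andP[] := osc (x * c * x0)%g.
have [c ct Uxc] := tU x.
have gc : g (x * c * x0)%g <= g x0 + e / 4.
  have -> : g x0 + e / 4 = avg s (fun a => f (x0 * a)%g + e / 4).
    by rewrite avgD avg_cst.
  apply: ler_avg => a _; have /ltW := Uxc (x0 * a)%g.
  by rewrite ler_distl mulgA => /andP[].
have -> : m + d * (1 - q) = (m + d) - d / 2 / (size t)%:R + d * q by rewrite dq; ring.
apply: (@le_trans _ _ ((m + d) - d / 2 / (size t)%:R)); last lra.
apply: (avg_le_one ct); last lra.
by move=> a; have /andP[] := osc (x * a * x0)%g.
Qed.

(** The infimum of the oscillations of averages cannot be positive, since an average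
    close to the infimum could be improved by a fixed factor. *)
Lemma right_avg_flat f e : continuous f -> 0 < e ->
  exists s c, (0 < size s)%N /\ forall x, `|avg s (fun a => f (x * a)%g) - c| <= e.
Proof.
move=> cf e0.
pose D := [set d | 0 <= d /\ exists s m, (0 < size s)%N /\
  forall x, m <= avg s (fun a => f (x * a)%g) <= m + d].
suff [d [[_ [s [m [s0 osc]]]] de]] : exists d, D d /\ d <= e.
  exists s, m; split=> // x; have /andP[? ?] := osc x.
  rewrite ler_distl; apply/andP; split; lra.
apply: contrapT => noD.
have geD d : D d -> e <= d.
  move=> Dd; rewrite leNgt; apply/negP => de; apply: noD.
  by exists d; split=> //; exact: ltW.
have D0 : D !=set0.
  have [c fc] := compact_bounded_fun cK cf.
  have c0 : 0 <= c by exact: le_trans (fc 1%g).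
  exists (2 * c); split; first lra.
  exists [:: 1%g], (- c); split=> // x; rewrite /avg big_seq1 /= invr1 mul1r mulg1.
  by have := fc x; rewrite ler_norml => /andP[? ?]; apply/andP; split; lra.
have infD : has_inf D by split=> //; exists e => d /geD.
have ei : e <= inf D by apply: lb_le_inf => // d /geD.
have [N N1 shrink] := oscillation_shrinks cf e0.
have q4 : (4 * N)^-1 <= 4^-1 by rewrite lef_pV2 ?posrE; lra.
have q0 : 0 < (4 * N)^-1 by rewrite invr_gt0; lra.
set q := (4 * N)^-1 in shrink q4 q0.
have gap : 0 < inf D * q by rewrite mulr_gt0 //; lra.
have [d Dd di] := inf_adherent gap infD.
have ed := geD _ Dd.
have [d0 [s [m [s0 osc]]]] := Dd.
have [s' [m' [s'0 osc']]] := shrink s m d s0 ed osc.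
have Dd' : D (d * (1 - q)).
  by split; [rewrite mulr_ge0 //; lra | exists s', m'].
have : inf D <= d * (1 - q) by apply: ge_inf => //; case: infD.
have : d * (1 - q) < (inf D + inf D * q) * (1 - q) by rewrite ltr_pM2r //; lra.
nra.
Qed.

Lemma left_avg_flat f e : continuous f -> 0 < e ->
  exists s c, (0 < size s)%N /\ forall x, `|avg s (fun a => f (a * x)%g) - c| <= e.
Proof.
move=> cf e0.
have cfV : continuous (fun x => f (x^-1)%g) by cts.
have [s [c [s0 flat]]] := right_avg_flat cfV e0.
exists [seq (a^-1)%g | a <- s], c; split; first by rewrite size_map.
move=> x; rewrite avg_map; have := flat (x^-1)%g.
by under eq_avg do rewrite invgM invgK.
Qed.

Lemma lower_bound_le f s t m d e : (0 < size s)%N -> (0 < size t)%N ->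
  (forall x, m <= avg s (fun a => f (x * a)%g)) ->
  (forall x, `|avg t (fun b => f (b * x)%g) - d| <= e) -> m <= d + e.
Proof.
move=> s0 t0 ms dt.
have h1 : m <= avg t (fun b => avg s (fun a => f (b * a)%g)) by apply: avg_ge.
apply: (le_trans h1); rewrite avg_exchange; apply: avg_le => // a.
by have := dt a; rewrite ler_distl => /andP[].
Qed.

(** Both constants are compared with the two-sided average, which is computed in
    either order because left and right translations commute. *)
Lemma flat_avgs_agree f s t c d e1 e2 : (0 < size s)%N -> (0 < size t)%N ->
  (forall x, `|avg s (fun a => f (x * a)%g) - c| <= e1) ->
  (forall x, `|avg t (fun b => f (b * x)%g) - d| <= e2) -> `|c - d| <= e1 + e2.
Proof.
move=> s0 t0 hs ht.
have h1 : `|avg t (fun b => avg s (fun a => f (b * a)%g)) - c| <= e1 by apply: avg_dist.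
have h2 : `|avg t (fun b => avg s (fun a => f (b * a)%g)) - d| <= e2.
  by rewrite avg_exchange; apply: avg_dist.
move: h1 h2; rewrite !ler_distl => /andP[? ?] /andP[? ?]; apply/andP; split; lra.
Qed.

Lemma mean_near_right f s c e : continuous f -> (0 < size s)%N ->
  (forall x, `|avg s (fun a => f (x * a)%g) - c| <= e) -> `|mean f - c| <= e.
Proof.
move=> cf s0 hs.
have ce : [set m | exists2 s, (0 < size s)%N &
    forall x, m <= avg s (fun a => f (x * a)%g)] (c - e).
  by exists s => // x; have := hs x; rewrite ler_distl => /andP[].
have ub m : (exists2 s, (0 < size s)%N & forall x, m <= avg s (fun a => f (x * a)%g)) ->
    m <= c + e.
  case=> s' s'0 ms'; apply/ler_addgt0Pr => d d0.
  have d2 : 0 < d / 2 by lra.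
  have [t [c' [t0 ht]]] := left_avg_flat cf d2.
  have := lower_bound_le s'0 t0 ms' ht.
  have := flat_avgs_agree s0 t0 hs ht.
  by rewrite ler_distl => /andP[? ?] ?; lra.
rewrite ler_distl; apply/andP; split.
  by apply: ub_le_sup => //; exists (c + e) => m /ub.
by apply: ge_sup; [exists (c - e) | move=> m /ub].
Qed.

Lemma mean_near_left f t c e : continuous f -> (0 < size t)%N ->
  (forall x, `|avg t (fun b => f (b * x)%g) - c| <= e) -> `|mean f - c| <= e.
Proof.
move=> cf t0 ht; apply/ler_addgt0Pr => d d0.
have d2 : 0 < d / 2 by lra.
have [s [c' [s0 hs]]] := right_avg_flat cf d2.
have := mean_near_right cf s0 hs; have := flat_avgs_agree s0 t0 hs ht.
by rewrite !ler_distl => /andP[? ?] /andP[? ?]; apply/andP; split; lra.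
Qed.

Lemma mean_approx_right f e : continuous f -> 0 < e ->
  exists2 s, (0 < size s)%N & forall x, `|avg s (fun a => f (x * a)%g) - mean f| <= e.
Proof.
move=> cf e0; have e2 : 0 < e / 2 by lra.
have [s [c [s0 hs]]] := right_avg_flat cf e2; exists s => // x.
have := mean_near_right cf s0 hs; have := hs x.
by rewrite !ler_distl => /andP[? ?] /andP[? ?]; apply/andP; split; lra.
Qed.

Lemma mean_approx_left f e : continuous f -> 0 < e ->
  exists2 s, (0 < size s)%N & forall x, `|avg s (fun a => f (a * x)%g) - mean f| <= e.
Proof.
move=> cf e0; have e2 : 0 < e / 2 by lra.
have [s [c [s0 hs]]] := left_avg_flat cf e2; exists s => // x.
have := mean_near_left cf s0 hs; have := hs x.
by rewrite !ler_distl => /andP[? ?] /andP[? ?]; apply/andP; split; lra.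
Qed.

Lemma mean_mulr f b : continuous f -> mean (fun x => f (x * b)%g) = mean f.
Proof.
move=> cf; apply: eq_of_dist_le => e e0.
have [t t0 ht] := mean_approx_left cf e0.
apply: (mean_near_left (t := t)) => //; first by cts.
by move=> x; under eq_avg do rewrite -mulgA; exact: ht.
Qed.

Lemma mean_mull f b : continuous f -> mean (fun x => f (b * x)%g) = mean f.
Proof.
move=> cf; apply: eq_of_dist_le => e e0.
have [t t0 ht] := mean_approx_right cf e0.
apply: (mean_near_right (s := t)) => //; first by cts.
by move=> x; under eq_avg do rewrite mulgA; exact: ht.
Qed.

Lemma mean_inv f : continuous f -> mean (fun x => f (x^-1)%g) = mean f.
Proof.
move=> cf; apply: eq_of_dist_le => e e0.
have [t t0 ht] := mean_approx_right cf e0.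
apply: (mean_near_left (t := [seq (a^-1)%g | a <- t])) => //; first by cts.
  by rewrite size_map.
move=> x; rewrite avg_map; under eq_avg do rewrite invgM invgK; exact: ht.
Qed.

Lemma mean_cst c : mean (fun=> c) = c.
Proof.
apply: eq_of_dist_le => e e0; apply: (mean_near_right (s := [:: 1%g])) => //.
  by cts.
by move=> x; rewrite avg_cst // subrr normr0 ltW.
Qed.

Lemma mean_avg_right f s : continuous f -> (0 < size s)%N ->
  mean (fun x => avg s (fun a => f (x * a)%g)) = mean f.
Proof.
move=> cf s0; apply: eq_of_dist_le => e e0.
have [t t0 ht] := mean_approx_left cf e0.
apply: (mean_near_left (t := t)) => //.
  rewrite /avg; apply: cts_mul; first by cts.
  by apply: cts_sum => a; cts.
move=> x; rewrite avg_exchange; apply: avg_dist => // a.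
by under eq_avg do rewrite -mulgA; exact: ht.
Qed.

Lemma cts_avg (X : topologicalType) (I : Type) (s : seq I) (F : I -> X -> R) :
  (forall i, continuous (F i)) -> continuous (fun x => avg s (fun i => F i x)).
Proof. by move=> cF; apply: cts_mul; [cts | exact: cts_sum]. Qed.

(** Averaging further does not spoil what has been achieved, so the functions can be
    flattened one after another. *)
Lemma mean_approx_seq (fs : seq (K -> R)) e :
  (forall f, f \in fs -> continuous f) -> 0 < e ->
  exists2 s, (0 < size s)%N & forall f, f \in fs ->
    forall x, `|avg s (fun a => f (x * a)%g) - mean f| <= e.
Proof.
move=> cfs e0; elim: fs cfs => [|f fs ih] cfs.
  by exists [:: 1%g].
have [|s s0 hs] := ih; first by move=> g gs; apply: cfs; rewrite inE gs orbT.
have cf : continuous f by apply: cfs; rewrite mem_head.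
pose g x := avg s (fun a => f (x * a)%g).
have cg : continuous g by apply: cts_avg => a; cts.
have [t t0 ht] := mean_approx_right cg e0.
exists [seq (b * a)%g | b <- t, a <- s]; first by rewrite size_allpairs muln_gt0 t0.
move=> h; rewrite inE => /orP[/eqP -> | hfs] x; rewrite avg_allpairs.
  have := ht x; rewrite /g mean_avg_right // => hh.
  by under eq_avg do under eq_avg do rewrite mulgA.
by apply: avg_dist => // b; under eq_avg do rewrite mulgA; exact: hs.
Qed.

Lemma meanD f g : continuous f -> continuous g ->
  mean (fun x => f x + g x) = mean f + mean g.
Proof.
move=> cf cg; apply: eq_of_dist_le => e e0; have e2 : 0 < e / 2 by lra.
have [|s s0 hs] := @mean_approx_seq [:: f; g] _ _ e2.
  by move=> h; rewrite !inE => /orP[] /eqP ->.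
apply: (mean_near_right (s := s)) => //; first by cts.
move=> x; rewrite avgD.
have := hs f (mem_head _ _) x.
have := hs g; rewrite !inE eqxx orbT => /(_ isT x).
by rewrite !ler_distl => /andP[? ?] /andP[? ?]; apply/andP; split; lra.
Qed.

Lemma meanZ c f : continuous f -> mean (fun x => c * f x) = c * mean f.
Proof.
move=> cf; apply: eq_of_dist_le => e e0.
have c0 : 0 < `|c| + 1 by rewrite ltr_wpDl.
have ec : 0 < e / (`|c| + 1) by rewrite divr_gt0.
have [s s0 hs] := mean_approx_right cf ec.
apply: (mean_near_right (s := s)) => //; first by cts.
move=> x; rewrite avgZ -mulrBr normrM.
apply: (@le_trans _ _ ((`|c| + 1) * (e / (`|c| + 1)))).
  by apply: ler_pM => //; rewrite lerDl.
by rewrite mulrC divfK // gt_eqF.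
Qed.

Lemma meanN f : continuous f -> mean (fun x => - f x) = - mean f.
Proof.
move=> cf; rewrite -mulN1r -meanZ //; congr mean.
by apply/funext => x; rewrite mulN1r.
Qed.

Lemma meanB f g : continuous f -> continuous g ->
  mean (fun x => f x - g x) = mean f - mean g.
Proof. by move=> cf cg; rewrite meanD ?meanN //; cts. Qed.

Lemma mean_sum (I : Type) (s : seq I) (F : I -> K -> R) :
  (forall i, continuous (F i)) ->
  mean (fun x => \sum_(i <- s) F i x) = \sum_(i <- s) mean (F i).
Proof.
move=> cF; elim: s => [|i s ih].
  by rewrite big_nil; under eq_fun do rewrite big_nil; exact: mean_cst.
under eq_fun do rewrite big_cons.
by rewrite big_cons -ih meanD //; exact: cts_sum.
Qed.

Lemma mean_ge0 f : continuous f -> (forall x, 0 <= f x) -> 0 <= mean f.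
Proof.
move=> cf f0; apply/ler_addgt0Pr => e e0.
have [s s0 /(_ 1%g)] := mean_approx_right cf e0.
have : 0 <= avg s (fun a => f (1 * a)%g) by apply: avg_ge.
by rewrite ler_distl => ? /andP[? ?]; lra.
Qed.

Lemma ler_mean f g : continuous f -> continuous g -> (forall x, f x <= g x) ->
  mean f <= mean g.
Proof.
move=> cf cg fg; rewrite -subr_ge0 -meanB //; apply: mean_ge0; first by cts.
by move=> x; rewrite subr_ge0.
Qed.

Lemma mean_dist f c e : continuous f -> (forall x, `|f x - c| <= e) -> `|mean f - c| <= e.
Proof.
move=> cf h; apply: (mean_near_right (s := [:: 1%g])) => // x.
exact: avg_dist.
Qed.

Lemma mean_norm f c : continuous f -> (forall x, `|f x| <= c) -> `|mean f| <= c.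
Proof.
by move=> cf h; rewrite -[mean f]subr0; apply: mean_dist => // x; rewrite subr0.
Qed.

(** Finitely many translates of the set where [f] exceeds [f x0 / 2] cover [K], so
    some average of [f] is bounded below by a positive constant. *)
Lemma mean_gt0 f x0 : continuous f -> (forall x, 0 <= f x) -> 0 < f x0 -> 0 < mean f.
Proof.
move=> cf f0 fx0.
have nU : nbhs (1%g : K) [set u | f x0 / 2 < f (u * x0)%g].
  have c1 : continuous (fun u => f (u * x0)%g) by cts.
  apply: (c1 1%g [set r | f x0 / 2 < r]); apply: open_nbhs_nbhs; split.
    exact: open_gt.
  by rewrite /= mul1g; lra.
have [t t0 tU] := translates_cover cK nU.
have N0 : 0 < (size t)%:R^-1 :> R by rewrite invr_gt0 ltr0n.
have c0 : 0 < (size t)%:R^-1 * (f x0 / 2) by rewrite mulr_gt0 //; lra.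
apply: (lt_le_trans c0).
rewrite -(mean_cst ((size t)%:R^-1 * (f x0 / 2))).
rewrite -(@mean_avg_right f [seq (a * x0)%g | a <- t]) // ?size_map //.
apply: ler_mean.
- by cts.
- by apply: cts_avg => a; cts.
move=> x; rewrite avg_map /avg ler_pM2l //.
have [a at_ /ltW] := tU x; rewrite -mulgA => h.
by rewrite (big_rem a at_) /= -[leLHS]addr0; apply: lerD => //; apply: sumr_ge0.
Qed.

Lemma cts_mean_param (X : topologicalType) (F : X * K -> R) :
  continuous F -> continuous (fun x => mean (fun y => F (x, y))).
Proof.
move=> cF x; apply/cvgrPdist_le => e e0.
have := near_parameter_unif cK x cF e0; apply: filterS => x' h.
have cx z : continuous (fun y => F (z, y)) by cts.
rewrite -meanB //; apply: mean_norm; first by apply: cts_add => //; apply: cts_opp.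
by move=> y; rewrite distrC ltW.
Qed.

(** Finitely many sections [F (i, _)] approximate all sections uniformly.  Averages
    that flatten these sections flatten every section, uniformly in the first
    variable, and a finite average commutes with [mean]. *)
Lemma mean_exchange (F : K * K -> R) : continuous F ->
  mean (fun x => mean (fun y => F (x, y))) = mean (fun y => mean (fun x => F (x, y))).
Proof.
move=> cF; apply: eq_of_dist_le => e e0; have e3 : 0 < e / 3 by lra.
have c1 z : continuous (fun y => F (z, y)) by cts.
have c2 z : continuous (fun y => F (y, z)) by cts.
have [] := @compact_cover_seq K K setT
  (fun i x => forall y, `|F (x, y) - F (i, y)| < e / 3) cK.
  by move=> x _; exists x; exact: near_parameter_unif.
move=> r rP.
have [|s s0 hs] := @mean_approx_seq [seq (fun y => F (i, y)) | i <- r] _ _ e3.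
  by move=> f /mapP[i _ ->].
have unif x y : `|avg s (fun a => F (x, y * a)%g) - mean (fun z => F (x, z))| <= e.
  have [i ir hi] := rP x Logic.I.
  have h1 := hs _ (map_f (fun i y => F (i, y)) ir) y.
  have h2 : `|mean (fun z => F (x, z)) - mean (fun z => F (i, z))| <= e / 3.
    rewrite -meanB //; apply: mean_norm; first by apply: cts_add => //; apply: cts_opp.
    by move=> z; exact: ltW.
  have h3 : `|avg s (fun a => F (x, y * a)%g - F (i, y * a)%g) - 0| <= e / 3.
    by apply: avg_dist => // a; rewrite subr0 ltW.
  have h4 : avg s (fun a => F (x, y * a)%g - F (i, y * a)%g) =
     avg s (fun a => F (x, y * a)%g) - avg s (fun a => F (i, y * a)%g).
    rewrite avgD -[X in _ = _ - X]mul1r -mulNr -avgZ; congr (_ + _).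
    by apply: eq_avg => a; rewrite mulN1r.
  move: h1 h2 h3; rewrite h4 !ler_distl /=.
  by move=> /andP[? ?] /andP[? ?] /andP[? ?]; apply/andP; split; lra.
rewrite distrC; apply: (mean_near_right (s := s)) => //.
  by apply: (@cts_mean_param _ (fun z => F (z.2, z.1))); cts.
move=> y.
have -> : avg s (fun a => mean (fun x => F (x, y * a)%g)) =
    mean (fun x => avg s (fun a => F (x, y * a)%g)).
  rewrite /avg meanZ; last by apply: cts_sum => a; cts.
  by rewrite mean_sum // => a; cts.
have cm : continuous (fun x => mean (fun z => F (x, z))) by exact: cts_mean_param.
rewrite -meanB //; last by apply: cts_avg => a; cts.
apply: mean_norm; last by move=> x; exact: unif.
by apply: cts_add; [apply: cts_avg => a; cts | apply: cts_opp].
Qed.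
End Mean.

(** * Convolution *)

Section Convolution.
Context {R : realType} {K : topologicalGroupType} (cK : compact [set: K]).
Implicit Types (f g h k : K -> R).

Definition ip f g : R := mean (fun x => f x * g x).

(** The usual [mean (fun y => f y * g (y^-1 * x))], after substituting [x * y] for
    [y]. *)
Definition conv f g : K -> R := fun x => mean (fun y => f (x * y)%g * g (y^-1)%g).

Lemma ipC f g : ip f g = ip g f.
Proof. by congr mean; apply/funext => x; rewrite mulrC. Qed.

Lemma ip_ge0 f : continuous f -> 0 <= ip f f.
Proof. by move=> cf; apply: mean_ge0 => //; [cts | move=> x; rewrite -expr2 sqr_ge0]. Qed.

Lemma ip_gt0 f x0 : continuous f -> f x0 != 0 -> 0 < ip f f.
Proof.
move=> cf fx0; apply: (mean_gt0 cK (x0 := x0)); first by cts.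
  by move=> x; rewrite -expr2 sqr_ge0.
by rewrite -expr2 exprn_even_gt0.
Qed.

Lemma ip_eq0 f : continuous f -> ip f f = 0 -> f = fun=> 0.
Proof.
move=> cf f0; apply/funext => x; apply/eqP; apply: contraT => fx.
by have := ip_gt0 cf fx; rewrite f0 ltxx.
Qed.

Lemma ip_lincomb f g h (a b : R) : continuous f -> continuous g -> continuous h ->
  ip (fun x => a * f x + b * g x) h = a * ip f h + b * ip g h.
Proof.
move=> cf cg ch; rewrite /ip -!meanZ //; [|by cts|by cts].
rewrite -meanD //; [|by cts|by cts].
by congr mean; apply/funext => x; ring.
Qed.

Lemma ip_sqr_lincomb f g (a b : R) : continuous f -> continuous g ->
  ip (fun x => a * f x + b * g x) (fun x => a * f x + b * g x) =
  a ^+ 2 * ip f f + 2 * a * b * ip f g + b ^+ 2 * ip g g.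
Proof.
move=> cf cg; rewrite ip_lincomb //; last by cts.
by rewrite ![ip _ (fun x => _ + _)]ipC !ip_lincomb // (ipC g f); ring.
Qed.

Lemma cauchy_schwarz f g : continuous f -> continuous g ->
  ip f g ^+ 2 <= ip f f * ip g g.
Proof.
move=> cf cg.
have [g0|g0] := eqVneq (ip g g) 0.
  rewrite (ip_eq0 cg g0) /ip.
  under eq_fun do rewrite mulr0.
  under [X in _ <= _ * mean X]eq_fun do rewrite mulr0.
  by rewrite mean_cst // expr0n /= mulr0.
have gp : 0 < ip g g by rewrite lt_def g0 ip_ge0.
have := ip_sqr_lincomb (ip g g) (- ip f g) cf cg => e.
have : 0 <= ip g g * (ip f f * ip g g - ip f g ^+ 2).
  have -> : ip g g * (ip f f * ip g g - ip f g ^+ 2) =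
    (ip g g) ^+ 2 * ip f f + 2 * (ip g g) * (- ip f g) * ip f g +
      (- ip f g) ^+ 2 * ip g g by ring.
  by rewrite -e; apply: ip_ge0; cts.
by rewrite pmulr_rge0 // subr_ge0.
Qed.

Lemma cts_conv f g : continuous f -> continuous g -> continuous (conv f g).
Proof.
move=> cf cg.
apply: (@cts_mean_param _ _ cK K (fun u : K * K => f (u.1 * u.2)%g * g (u.2^-1)%g)).
by cts.
Qed.

Lemma conv_shift f g x z : continuous f -> continuous g ->
  conv f g x = mean (fun y => f (x * z * y)%g * g (y^-1 * z^-1)%g).
Proof.
move=> cf cg.
rewrite /conv -(@mean_mull _ _ cK (fun y => f (x * y)%g * g (y^-1)%g) z); last by cts.
by congr mean; apply/funext => y; rewrite mulgA invgM.
Qed.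

Lemma convA f g h : continuous f -> continuous g -> continuous h ->
  conv (conv f g) h = conv f (conv g h).
Proof.
move=> cf cg ch; apply/funext => x.
have -> : conv (conv f g) h x = mean (fun y => mean (fun z =>
    f (x * z)%g * g (z^-1 * y)%g * h (y^-1)%g)).
  congr mean; apply/funext => y; rewrite (conv_shift (x * y)%g y^-1%g cf cg).
  rewrite mulrC -meanZ //; last by cts.
  by congr mean; apply/funext => z; rewrite mulgK invgK mulrC.
rewrite (mean_exchange cK (F := fun u : K * K =>
  f (x * u.2)%g * g (u.2^-1 * u.1)%g * h (u.1^-1)%g)) /=; last by cts.
congr mean; apply/funext => z; rewrite -meanZ //; last by cts.
by congr mean; apply/funext => y; rewrite mulrA.
Qed.

Lemma convV f g x : continuous f -> continuous g ->
  conv f g (x^-1)%g = conv (fun y => g (y^-1)%g) (fun y => f (y^-1)%g) x.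
Proof.
move=> cf cg; rewrite (conv_shift _ x cf cg); congr mean; apply/funext => y.
by rewrite mulVg mul1g invgK invgM mulrC.
Qed.

Lemma conv1 f g : conv f g 1%g = ip f (fun y => g (y^-1)%g).
Proof. by congr mean; apply/funext => y; rewrite mul1g. Qed.

(** Convolution on the left commutes with right translations; hence eigenspaces are
    invariant under right translations. *)
Lemma conv_mulr f g x q : continuous f -> continuous g ->
  conv f g (x * q)%g = conv f (fun y => g (y * q)%g) x.
Proof.
move=> cf cg; rewrite (conv_shift _ q^-1%g cf cg); congr mean; apply/funext => y.
by rewrite mulgK invgK.
Qed.

Lemma ip_mull f g z : continuous f -> continuous g ->
  ip (fun y => f (z * y)%g) (fun y => g (z * y)%g) = ip f g.
Proof.
by move=> cf cg; rewrite /ip (mean_mull cK (f := fun y => f y * g y)) //; cts.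
Qed.

Lemma ipV f g : continuous f -> continuous g ->
  ip (fun y => f (y^-1)%g) (fun y => g (y^-1)%g) = ip f g.
Proof. by move=> cf cg; rewrite /ip (mean_inv cK (f := fun y => f y * g y)) //; cts. Qed.

Lemma conv_sqr_le f g x : continuous f -> continuous g ->
  conv f g x ^+ 2 <= ip f f * ip g g.
Proof.
move=> cf cg; rewrite -(ip_mull x cf cf) -(ipV cg cg).
by apply: cauchy_schwarz; cts.
Qed.

Lemma conv_lincomb f g h (a b : R) : continuous f -> continuous g -> continuous h ->
  conv f (fun x => a * g x + b * h x) = fun x => a * conv f g x + b * conv f h x.
Proof.
move=> cf cg ch; apply/funext => x; rewrite /conv -!meanZ //; [|by cts|by cts].
rewrite -meanD //; [|by cts|by cts].
by congr mean; apply/funext => y; ring.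
Qed.

Lemma convZ f g (a : R) : continuous f -> continuous g ->
  conv f (fun x => a * g x) = fun x => a * conv f g x.
Proof.
move=> cf cg; apply/funext => x; rewrite /conv -!meanZ //; last by cts.
by congr mean; apply/funext => y; ring.
Qed.

Lemma conv0 f : conv f (fun=> 0) = fun=> 0.
Proof.
apply/funext => x; rewrite /conv; under eq_fun do rewrite mulr0.
exact: mean_cst.
Qed.

Lemma conv0l f : conv (fun=> 0) f = fun=> 0.
Proof.
apply/funext => x; rewrite /conv; under eq_fun do rewrite mul0r.
exact: mean_cst.
Qed.

End Convolution.

Section RatioLimit.
Context {R : realType} (A : nat -> R).
Hypothesis A0 : forall n, 0 < A n.
Hypothesis logconvex : forall n, A n.+1 ^+ 2 <= A n * A n.+2.
Hypothesis submult : forall n m, A (n + m).+1 <= A n * A m.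

(** The ratios [A n.+1 / A n] increase by log-convexity and are bounded by [A 0];
    let [l] be their supremum.  From index [i] on the sequence grows at least by the
    factor [r i], so [A i * r i ^+ n.+1 <= A (i + n).+1 <= A i * A n], which gives
    [r i ^+ n.+1 <= A n] for all [i], and the limit in [i] is the lower bound. *)
Lemma growth_rate : exists2 l, 0 < l &
  (forall n, A n.+1 <= l * A n) /\ (forall n, l ^+ n.+1 <= A n).
Proof.
pose r n := A n.+1 / A n.
have rE n : A n.+1 = r n * A n by rewrite /r divfK // gt_eqF.
have r0 n : 0 < r n by rewrite divr_gt0.
have rS n : r n <= r n.+1.
  by rewrite ler_pdivrMr // mulrAC ler_pdivlMr // -expr2 [leRHS]mulrC.
have rmono m n : (m <= n)%N -> r m <= r n.
  by move: m n; apply/nondecreasing_seqP.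
have rle i n : r i ^+ n.+1 <= A n.
  suff : A i * r i ^+ n.+1 <= A (i + n).+1.
    move=> /le_trans /(_ (submult i n)); by rewrite ler_pM2l.
  elim: n => [|n ih]; first by rewrite expr1 addn0 rE mulrC.
  rewrite exprS mulrCA addnS [leRHS]rE; apply: ler_pM => //.
  - exact: ltW.
  - by rewrite mulr_ge0 ?exprn_ge0 // ltW.
  by apply: rmono; rewrite leqW // leq_addr.
have ub i : r i <= A 0%N by have := rle i 0%N; rewrite expr1.
have hs : has_sup (range r).
  by split; [exists (r 0%N); exists 0%N | exists (A 0%N) => _ [i _ <-]].
have rsup n : r n <= sup (range r) by apply: ub_le_sup; [case: hs | exists n].
have l0 : 0 < sup (range r) by apply: lt_le_trans (rsup 0%N).
exists (sup (range r)) => //; split=> n; first by rewrite rE ler_pM2r.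
have rootK : (A n `^ (n.+1%:R^-1)) ^+ n.+1 = A n.
  by rewrite -powR_mulrn ?powR_ge0 // -powRrM mulVf // powRr1 // ltW.
have le_r : sup (range r) <= A n `^ (n.+1%:R^-1).
  apply: ge_sup; first by exists (r 0%N); exists 0%N.
  move=> _ [i _ <-]; rewrite -(@ler_pXn2r _ n.+1) ?nnegrE ?powR_ge0 //; last exact: ltW.
  by rewrite rootK.
by rewrite -[leRHS]rootK ler_pXn2r ?nnegrE ?powR_ge0 // ltW.
Qed.

End RatioLimit.

Lemma uniform_cauchy_limit (R : realType) (X : topologicalType) (h : nat -> X -> R) :
  (forall n, continuous (h n)) ->
  (forall e, 0 < e -> exists N, forall n m, (N <= n)%N -> (N <= m)%N ->
     forall x, `|h n x - h m x| <= e) ->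
  exists2 f : X -> R, continuous f & forall e, 0 < e ->
    exists N, forall n, (N <= n)%N -> forall x, `|h n x - f x| <= e.
Proof.
move=> ch cau.
have cvgh x : cvgn (fun n => h n x).
  apply/cauchy_cvgP/cauchy_ballP => e e0.
  have e2 : 0 < e / 2 by lra.
  have [N hN] := cau _ e2.
  pose B := [set h n x | n in [set n | (N <= n)%N]].
  have FB : ((fun n => h n x) @ \oo) B by exists N => // n Nn; exists n.
  exists (B, B) => // -[_ _] [/= [n Nn <-] [m Nm <-]].
  by rewrite /ball /=; apply: le_lt_trans (hN n m Nn Nm x) _; lra.
pose f x := limn (fun n => h n x).
have unif e : 0 < e -> exists N, forall n, (N <= n)%N -> forall x, `|h n x - f x| <= e.
  move=> e0; have [N hN] := cau _ e0; exists N => n Nn x.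
  rewrite ler_distl; apply/andP; split; last first.
    rewrite -lerBlDr; apply: limr_ge; first exact: cvgh.
    exists N => // m Nm /=; have := hN n m Nn Nm x.
    by rewrite ler_distl => /andP[? ?]; lra.
  rewrite lerBlDr; apply: limr_le; first exact: cvgh.
  exists N => // m Nm /=; have := hN n m Nn Nm x.
  by rewrite ler_distl => /andP[? ?]; lra.
exists f => // x; apply/cvgrPdist_le => e e0; have e3 : 0 < e / 3 by lra.
have [N hN] := unif _ e3.
have /cvgrPdist_le /(_ _ e3) := ch N x; apply: filterS => y.
have := hN N (leqnn N) x; have := hN N (leqnn N) y.
rewrite !ler_distl => /andP[? ?] /andP[? ?] /andP[? ?]; apply/andP; split; lra.
Qed.

(** * An eigenfunction of a convolution operator *)

Section Spectral.
Context {R : realType} {K : topologicalGroupType} (cK : compact [set: K]).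
Implicit Types (f g h k : K -> R).

Section Smoothing.
Context (v : K -> R) (cv : continuous v).

Lemma ip_smooth f g c d : continuous f -> continuous g -> (forall x, `|v x| <= c) ->
  (forall x, `|f x - g x| <= d) -> `|ip v f - ip v g| <= c * d.
Proof.
move=> cf cg vc fg; rewrite /ip -meanB //; [|by cts|by cts].
apply: (mean_norm cK); first by cts.
by move=> x; rewrite -mulrBr normrM; apply: ler_pM.
Qed.

Lemma conv_smooth f g c d x : continuous f -> continuous g -> (forall x, `|v x| <= c) ->
  (forall x, `|f x - g x| <= d) -> `|conv v f x - conv v g x| <= c * d.
Proof.
move=> cf cg vc fg; rewrite /conv -meanB //; [|by cts|by cts].
apply: (mean_norm cK); first by cts.
by move=> y; rewrite -mulrBr normrM; apply: ler_pM.
Qed.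

(** Convolution with the continuous [v] maps the L2 norm boundedly to the uniform
    norm, so the shift relation [conv v (h n) = l * h n.+1] upgrades L2 Cauchy to
    uniformly Cauchy.  The bound on [ip v (h n)] keeps the limit from vanishing. *)
Lemma limit_eigenfunction (h : nat -> K -> R) (l : R) : 0 < l ->
  (forall n, continuous (h n)) ->
  (forall n, conv v (h n) = fun x => l * h n.+1 x) ->
  (forall e, 0 < e -> exists N, forall n m, (N <= n)%N -> (N <= m)%N ->
    ip (fun x => h n x - h m x) (fun x => h n x - h m x) <= e) ->
  (forall n, l <= ip v (h n)) ->
  exists2 e, continuous e & conv v e = (fun x => l * e x) /\ 0 < ip v e.
Proof.
move=> l0 ch hS cauL2 ge_l.
have [c vc] := compact_bounded_fun cK cv.
have c0 : 0 <= c by exact: le_trans (vc 1%g).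
have C0 : 0 < ip v v + 1 by rewrite ltr_wpDl // ip_ge0.
have cauSup e : 0 < e -> exists N, forall n m, (N <= n)%N -> (N <= m)%N ->
    forall x, `|h n x - h m x| <= e.
  move=> e0.
  have le0 : 0 < (l * e) ^+ 2 / (ip v v + 1) by rewrite divr_gt0 // exprn_gt0 // mulr_gt0.
  (* The uniform estimate at [n.+1], [m.+1] comes from the L2 estimate at [n], [m]. *)
  have [N hN] := cauL2 _ le0; exists N.+1 => -[|n] [|m] // Nn Nm x.
  have := hN n m Nn Nm; rewrite ler_pdivlMr // mulrC => hnm.
  rewrite -(ler_pM2l l0) -[X in X * `|_|](gtr0_norm l0) -normrM.
  rewrite -(@ler_pXn2r _ 2) ?nnegrE ?mulr_ge0 ?(ltW l0) ?(ltW e0) //.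
  rewrite real_normK ?num_real //.
  apply: le_trans hnm.
  have cnm : continuous (fun y => h n y - h m y).
    by apply: cts_add; [exact: ch | apply: cts_opp; exact: ch].
  have -> : l * (h n.+1 x - h m.+1 x) = conv v (fun y => h n y - h m y) x.
    have -> : (fun y => h n y - h m y) = (fun y => 1 * h n y + (-1) * h m y).
      by apply/funext => y; ring.
    rewrite (conv_lincomb cK 1 (-1) cv (ch n) (ch m)) (hS n) (hS m); ring.
  apply: le_trans (conv_sqr_le cK x cv cnm) _.
  by rewrite ler_wpM2r ?lerDl // ip_ge0.
have [e ce he] := uniform_cauchy_limit ch cauSup.
exists e => //; split.
  apply/funext => x; apply: eq_of_dist_le => d d0.
  have D0 : 0 < c + l by rewrite ltr_wpDl.
  have dC : 0 < d / (c + l) by rewrite divr_gt0.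
  have [N hN] := he _ dC.
  have h1 := conv_smooth x (ch N) ce vc (hN N (leqnn N)).
  have h2 : `|l * h N.+1 x - l * e x| <= l * (d / (c + l)).
    by rewrite -mulrBr normrM (gtr0_norm l0) ler_pM2l // hN.
  have dE : d = c * (d / (c + l)) + l * (d / (c + l)).
    by rewrite -mulrDl mulrC divfK // gt_eqF.
  rewrite (hS N) in h1; rewrite [in leRHS]dE.
  move: h1 h2; rewrite !ler_distl => /andP[? ?] /andP[? ?]; apply/andP; split; lra.
have D0 : 0 < c + 1 by rewrite ltr_wpDl.
have dd : 0 < l / 2 / (c + 1) by rewrite !divr_gt0.
have [N hN] := he _ dd.
have := ip_smooth (ch N) ce vc (hN N (leqnn N)).
rewrite ler_distl => /andP[_ ?]; have := ge_l N.
have : c * (l / 2 / (c + 1)) <= l / 2.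
  rewrite mulrA ler_pdivrMr // mulrC ler_wpM2l //; lra.
lra.
Qed.

End Smoothing.

Section Powers.
Context (k : K -> R) (ck : continuous k) (kV : forall x, k (x^-1)%g = k x).
Context (x0 : K) (kx0 : k x0 != 0).

(** [cpow n] is the convolution power of exponent [n.+1]: there is no unit for
    convolution among the continuous functions. *)
Definition cpow n : K -> R := iter n (conv k) k.

Lemma cts_cpow n : continuous (cpow n).
Proof. by elim: n => //= n ih; exact: cts_conv. Qed.

Lemma cpowD n m : conv (cpow n) (cpow m) = cpow (n + m).+1.
Proof.
elim: n => //= n ih.
by rewrite convA // ?ih //; exact: cts_cpow.
Qed.

Lemma cpowV n x : cpow n (x^-1)%g = cpow n x.
Proof.
elim: n x => //= n ih x; rewrite convV //; last exact: cts_cpow.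
have -> : (fun y => cpow n (y^-1)%g) = cpow n by apply/funext => y.
have -> : (fun y => k (y^-1)%g) = k by apply/funext.
by have := cpowD n 0; rewrite addn0 /= => ->.
Qed.

Lemma ip_cpow n m : ip (cpow n) (cpow m) = cpow (n + m).+1 1%g.
Proof.
by rewrite -cpowD conv1; congr ip; apply/funext => y; rewrite cpowV.
Qed.

(* The even powers, of exponent [2 * n.+1], are kernels of positive operators;
   their values [A n] at 1 are the traces of these operators. *)
Let v n := cpow n.*2.+1.
Let A n := v n 1%g.

Lemma ip_even n m : ip (v n) (v m) = A (n + m).+1.
Proof. by rewrite /A /v ip_cpow doubleS doubleD addSn addnS. Qed.

Lemma trace_ip n : A n = ip (cpow n) (cpow n).
Proof. by rewrite ip_cpow addnn. Qed.

Lemma trace_bound n x : `|v n x| <= A n.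
Proof.
have A0 : 0 <= A n by rewrite trace_ip; exact: (ip_ge0 cK (@cts_cpow n)).
rewrite -(@ler_pXn2r _ 2) ?nnegrE // real_normK ?num_real //.
have := conv_sqr_le cK x (@cts_cpow n) (@cts_cpow n).
by rewrite cpowD addnn -/(v n) -trace_ip -expr2.
Qed.

Lemma trace_logconvex n : A n.+1 ^+ 2 <= A n * A n.+2.
Proof.
have -> : A n.+1 = ip (cpow n) (cpow n.+2).
  by rewrite ip_cpow /A /v doubleS !addnS addnn.
rewrite (trace_ip n) (trace_ip n.+2).
exact: (cauchy_schwarz cK (@cts_cpow n) (@cts_cpow n.+2)).
Qed.

Lemma trace_submult n m : A (n + m).+1 <= A n * A m.
Proof.
rewrite -ip_even; apply: le_trans (ler_norm _) _.
apply: (mean_norm cK); first by apply: cts_mul; exact: cts_cpow.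
by move=> x; rewrite normrM; apply: ler_pM => //; exact: trace_bound.
Qed.

Lemma trace_gt0 n : 0 < A n.
Proof.
have A0 : 0 < A 0%N by rewrite trace_ip; exact: (ip_gt0 cK ck kx0).
suff : 0 < A n /\ 0 < A n.+1 by case.
elim: n => [|n [An An1]].
  split=> //; rewrite trace_ip; apply: (ip_gt0 cK (@cts_cpow 1) (x0 := 1%g)).
  by rewrite gt_eqF.
split; first exact: An1.
have : 0 < A n * A n.+2 by apply: lt_le_trans (trace_logconvex n); rewrite exprn_gt0.
by rewrite pmulr_rgt0.
Qed.

(** Power iteration: the normalized even powers [h n] satisfy
    [ip (h n) (h m) = b (n + m).+1] with [b] nonincreasing and bounded below by 1, so
    they are Cauchy in the L2 norm. *)
Lemma dominant_eigenfunction : exists l e, [/\ 0 < l, continuous e,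
  conv (conv k k) e = (fun x => l * e x) & 0 < ip e (conv k k)].
Proof.
have [l l0 [grow low]] := growth_rate trace_gt0 trace_logconvex trace_submult.
have lX n : 0 < l ^+ n by rewrite exprn_gt0.
have l_neq0 : l != 0 by rewrite gt_eqF.
pose b n := A n / l ^+ n.+1.
have b1 n : 1 <= b n by rewrite /b ler_pdivlMr // mul1r.
have bS n : b n.+1 <= b n.
  rewrite /b ler_pdivrMr // mulrAC ler_pdivlMr //.
  have -> : A n * l ^+ n.+2 = (l * A n) * l ^+ n.+1 by rewrite [in LHS]exprS; ring.
  by rewrite ler_pM2r.
have bmono m n : (m <= n)%N -> b n <= b m.
  by move: m n; apply/nonincreasing_seqP.
have hb : has_inf (range b).
  by split; [exists (b 0%N); exists 0%N | exists 1 => _ [n _ <-]].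
have ipb n m : ip (v n) (v m) / l ^+ n.+1 / l ^+ m.+1 = b (n + m).+1.
  by rewrite ip_even /b -mulrA -invfM -exprD addSn addnS.
pose h n x := (l ^+ n.+1)^-1 * v n x.
have cv n : continuous (v n) by exact: cts_cpow.
have ch n : continuous (h n) by apply: cts_mul; [exact: cts_cst | exact: cv].
have ip_h n m : ip (fun x => h n x - h m x) (fun x => h n x - h m x) =
    b (n + n).+1 - 2 * b (n + m).+1 + b (m + m).+1.
  have -> : (fun x => h n x - h m x) =
      (fun x => (l ^+ n.+1)^-1 * v n x + (- (l ^+ m.+1)^-1) * v m x).
    by apply/funext => x; rewrite /h; ring.
  by rewrite ip_sqr_lincomb // -!ipb; ring.
have cauL2 e : 0 < e -> exists N, forall n m, (N <= n)%N -> (N <= m)%N ->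
    ip (fun x => h n x - h m x) (fun x => h n x - h m x) <= e.
  move=> e0; have e2 : 0 < e / 2 by lra.
  have [_ [N _ <-] bN] := inf_adherent e2 hb.
  exists N => n m Nn Nm; rewrite ip_h.
  have low' j : inf (range b) <= b j by apply: ge_inf; [case: hb | exists j].
  have := bmono N (n + n).+1 (leqW (leq_trans Nn (leq_addr _ _))).
  have := bmono N (m + m).+1 (leqW (leq_trans Nm (leq_addr _ _))).
  by have := low' (n + m).+1; lra.
have hS n : conv (v 0%N) (h n) = fun x => l * h n.+1 x.
  rewrite /h (convZ cK _ (cv 0%N) (cv n)) cpowD; apply/funext => x /=.
  by rewrite [in RHS]exprS invfM !mulrA mulfV // mul1r.
have ge_l n : l <= ip (v 0%N) (h n).
  have -> : ip (v 0%N) (h n) = l * b n.+1.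
    rewrite -[n.+1]add0n addnS -ipb expr1 ipC /h.
    have -> : (fun x => (l ^+ n.+1)^-1 * v n x) =
       (fun x => (l ^+ n.+1)^-1 * v n x + 0 * v n x) by apply/funext => x; ring.
    rewrite (ip_lincomb cK _ _ (cv n) (cv n) (cv 0%N)) (ipC (v 0%N)).
    by field; rewrite l_neq0 expf_neq0.
  by rewrite -[leLHS]mulr1 ler_pM2l.
have [e ce [ve ev]] := limit_eigenfunction (cv 0%N) l0 ch hS cauL2 ge_l.
by exists l, e; split=> //; rewrite ipC.
Qed.

End Powers.
End Spectral.

(** * Representative functions of a compact group *)

Section PeterWeyl.
Context {R : realType} {K : topologicalGroupType} (cK : compact [set: K]).
Implicit Types (f g h k : K -> R).

(** Families are indexed by [nat], with a bound, so that they can be extended by one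
    function without a change of type. *)
Definition orthonormal n (g : nat -> K -> R) :=
  forall i j, (i < n)%N -> (j < n)%N -> ip (g i) (g j) = (i == j)%:R.

Lemma ip_suml n (g : nat -> K -> R) (c : nat -> R) f :
  (forall i, continuous (g i)) -> continuous f ->
  ip (fun x => \sum_(i < n) c i * g i x) f = \sum_(i < n) c i * ip (g i) f.
Proof.
move=> cg cf; rewrite /ip.
under eq_fun do rewrite mulr_suml.
rewrite mean_sum //; last by move=> i; cts.
apply: eq_bigr => i _; rewrite -meanZ //; last by cts.
by congr mean; apply/funext => x; rewrite mulrA.
Qed.

Lemma ip_fourier n (g : nat -> K -> R) (c : nat -> R) j :
  (forall i, continuous (g i)) -> orthonormal n g -> (j < n)%N ->
  ip (fun x => \sum_(i < n) c i * g i x) (g j) = c j.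
Proof.
move=> cg on jn; rewrite ip_suml // (bigD1 (Ordinal jn)) //= on // eqxx mulr1.
rewrite big1 ?addr0 // => i ij; rewrite on //.
by rewrite (_ : (i == j :> nat) = false) ?mulr0 //; apply: negbTE; rewrite -val_eqE in ij.
Qed.

Lemma bessel n (g : nat -> K -> R) f :
  (forall i, continuous (g i)) -> orthonormal n g -> continuous f ->
  \sum_(i < n) ip f (g i) ^+ 2 <= ip f f.
Proof.
move=> cg on cf.
pose p x := \sum_(i < n) ip f (g i) * g i x.
have cp : continuous p by apply: cts_sum => i; cts.
have pg j : (j < n)%N -> ip p (g j) = ip f (g j).
  exact: (ip_fourier (fun i => ip f (g i)) cg on).
have pf : ip p f = \sum_(i < n) ip f (g i) ^+ 2.
  rewrite (ip_suml n (fun i => ip f (g i))) //.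
  by apply: eq_bigr => i _; rewrite ipC expr2.
have pp : ip p p = \sum_(i < n) ip f (g i) ^+ 2.
  rewrite (ip_suml n (fun i => ip f (g i))) //; apply: eq_bigr => i _.
  by rewrite expr2; congr (_ * _); rewrite ipC; exact: pg.
have : 0 <= ip (fun x => 1 * f x + (-1) * p x) (fun x => 1 * f x + (-1) * p x).
  by apply: ip_ge0 => //; cts.
rewrite ip_sqr_lincomb // (ipC f) pf pp; lra.
Qed.

Section Eigenspace.
Context (v : K -> R) (cv : continuous v) (l : R) (l0 : 0 < l).

Definition eigenfunction f :=
  continuous f /\ conv v f = (fun x => l * f x).

Lemma eigenfunction_mulr f q : eigenfunction f -> eigenfunction (fun x => f (x * q)%g).
Proof.
move=> [cf vf]; split; first by cts.
by apply/funext => x; rewrite -conv_mulr // vf.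
Qed.

Lemma eigenfunction_lincomb f g (a b : R) : eigenfunction f -> eigenfunction g ->
  eigenfunction (fun x => a * f x + b * g x).
Proof.
move=> [cf vf] [cg vg]; split; first by cts.
by rewrite conv_lincomb // vf vg; apply/funext => x; ring.
Qed.

Lemma eigenfunction0 : eigenfunction (fun=> 0).
Proof.
by split; [cts | apply/funext => x; rewrite conv0 // mulr0]. Qed.

Lemma eigenfunction_sum n (g : nat -> K -> R) (c : nat -> R) :
  (forall i, eigenfunction (g i)) -> eigenfunction (fun x => \sum_(i < n) c i * g i x).
Proof.
move=> eg; elim: n => [|n ih].
  by under eq_fun do rewrite big_ord0; exact: eigenfunction0.
have -> : (fun x => \sum_(i < n.+1) c i * g i x) =
    (fun x => 1 * (\sum_(i < n) c i * g i x) + c n * g n x).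
  by apply/funext => x; rewrite big_ord_recr mul1r.
exact: eigenfunction_lincomb.
Qed.

(** For an eigenfunction, [l * g x] is the inner product of [g] with the translated
    kernel [y |-> v (x y^-1)], whose norm does not depend on [x].  Bessel's
    inequality at each [x], then the mean over [x], bounds the size of the family. *)
Lemma orthonormal_eigenfunctions_bound n (g : nat -> K -> R) :
  (forall i, eigenfunction (g i)) -> orthonormal n g -> n%:R * l ^+ 2 <= ip v v.
Proof.
move=> eg on; have cg i : continuous (g i) by case: (eg i).
have pointwise x : \sum_(i < n) (l * g i x) ^+ 2 <= ip v v.
  have ck : continuous (fun y => v (x * y^-1)%g) by cts.
  have -> : ip v v = ip (fun y => v (x * y^-1)%g) (fun y => v (x * y^-1)%g).
    rewrite -(ip_mull cK x cv cv).
    by rewrite -(ipV cK (f := fun y => v (x * y)%g) (g := fun y => v (x * y)%g)) //; cts.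
  apply: le_trans (bessel cg on ck); apply: ler_sum => i _.
  suff -> : l * g i x = ip (fun y => v (x * y^-1)%g) (g i) by [].
  have /(congr1 (fun h => h x)) <- := proj2 (eg i).
  rewrite /conv -(mean_inv cK) /=; last by cts.
  by congr mean; apply/funext => y; rewrite invgK.
have : mean (fun x => \sum_(i < n) (l * g i x) ^+ 2) <= mean (fun _ : K => ip v v).
  by apply: ler_mean => //; [apply: cts_sum => i; cts | cts].
rewrite mean_cst // mean_sum //; last by move=> i; cts.
rewrite (eq_bigr (fun=> l ^+ 2)) => [|i _].
  by rewrite sumr_const card_ord mulr_natl.
have -> : (fun x => (l * g i x) ^+ 2) = (fun x => l ^+ 2 * (g i x * g i x)).
  by apply/funext => x; ring.
rewrite meanZ //; last by cts.
by rewrite -/(ip _ _) on // eqxx mulr1.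
Qed.

(** An orthonormal family of maximal size spans: the normalized remainder of an
    eigenfunction outside the span would extend the family. *)
Lemma eigenspace_finite_dim : exists n (g : nat -> K -> R),
  (forall i, eigenfunction (g i)) /\
  forall f, eigenfunction f -> exists c : nat -> R, f = fun x => \sum_(i < n) c i * g i x.
Proof.
pose P n := exists2 g : nat -> K -> R, (forall i, eigenfunction (g i)) & orthonormal n g.
have P0 : exists n, `[< P n >].
  exists 0%N; apply/asboolP; exists (fun _ _ => 0) => // i; exact: eigenfunction0.
have Pub n : `[< P n >] -> (n <= Num.truncn (ip v v / l ^+ 2))%N.
  move=> /asboolP [g eg on]; rewrite truncn_ge_nat; last first.
    by rewrite divr_ge0 ?exprn_ge0 ?(ltW l0) // ip_ge0.
  by rewrite ler_pdivlMr ?exprn_gt0 // (orthonormal_eigenfunctions_bound eg).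
case: (ex_maxnP P0 Pub) => n /asboolP[g eg on] nmax.
have cg i : continuous (g i) by case: (eg i).
exists n, g; split=> // f ef; have cf := proj1 ef.
exists (fun i => ip f (g i)).
pose p x := \sum_(i < n) ip f (g i) * g i x.
have ep : eigenfunction p by exact: (eigenfunction_sum n (fun i => ip f (g i)) eg).
pose r x := 1 * f x + (-1) * p x.
have er : eigenfunction r by exact: eigenfunction_lincomb.
have cr := proj1 er; have cp := proj1 ep.
have rg j : (j < n)%N -> ip r (g j) = 0.
  move=> jn; rewrite ip_lincomb //.
  have -> : ip p (g j) = ip f (g j) by exact: (ip_fourier (fun i => ip f (g i)) cg on).
  lra.
have [rr|rr] := eqVneq (ip r r) 0.
  have := ip_eq0 cK cr rr => r0; apply/funext => x.
  by have := congr1 (fun h => h x) r0; rewrite /r /p; lra.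
have rr0 : 0 < ip r r by rewrite lt_def rr ip_ge0.
suff : (n.+1 <= n)%N by rewrite ltnn.
apply: nmax; apply/asboolP.
pose a := (Num.sqrt (ip r r))^-1.
have aa : a * (a * ip r r) = 1.
  rewrite /a -[X in _ * (_ * X)]sqr_sqrtr ?(ltW rr0) //.
  by field; rewrite sqrtr_eq0 -ltNge.
pose u x := a * r x + 0 * r x.
have eu : eigenfunction u by exact: eigenfunction_lincomb.
have ipu h : continuous h -> ip u h = a * ip r h.
  by move=> ch; rewrite ip_lincomb //; ring.
exists (fun i => if i == n then u else g i) => [i|i j]; first by case: eqP.
rewrite 2!ltnS (leq_eqVlt i) (leq_eqVlt j).
have uu : ip u u = 1 by rewrite ipu; [rewrite ipC ipu // | case: eu].
case: (eqVneq i n) => [-> _|ni /= iin]; case: (eqVneq j n) => [-> _|_ /= jn].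
- exact: uu.
- by rewrite ipu // rg // mulr0.
- by rewrite ipC ipu // rg // mulr0 (negbTE ni).
- exact: on.
Qed.

End Eigenspace.

(** The kernel [w] is built from the difference [D] of [k] and its right translate
    by [p], so a function invariant under right translation by [p] has convolution
    zero with [w]; the dominant eigenfunction of [w] is therefore not invariant. *)
Lemma exists_representative_function k p : continuous k -> k p != k 1%g ->
  exists (f : K -> R) n (b : nat -> K -> R),
    [/\ f p != f 1%g, continuous f, forall i, continuous (b i) &
        forall q, exists c : nat -> R, forall x, f (x * q)%g = \sum_(i < n) c i * b i x].
Proof.
move=> ck kp.
pose D x := k x - k (x * p)%g.
have cD : continuous D by rewrite /D; cts.
pose D' x := D (x^-1)%g.
have cD' : continuous D' by rewrite /D'; cts.
pose w := conv D' D.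
have cw : continuous w by exact: cts_conv.
have wV x : w (x^-1)%g = w x.
  rewrite /w convV //.
  have -> : (fun y => D' (y^-1)%g) = D by apply/funext => y; rewrite /D' invgK.
  by [].
have w1 : w 1%g != 0.
  rewrite /w conv1 gt_eqF //; apply: (ip_gt0 cK cD' (x0 := 1%g)).
  by rewrite /D' /D invg1 mul1g subr_eq0 eq_sym.
have [l [e [l0 ce ve ew]]] := dominant_eigenfunction cK cw wV w1.
have cww : continuous (conv w w) by exact: cts_conv.
have [n [g [eg gspan]]] := eigenspace_finite_dim cww l0.
have ee : eigenfunction (conv w w) l e by [].
have [x ex] : exists x, e (x * p)%g != e x.
  apply: contrapT => nox.
  have ep x : e (x * p)%g = e x.
    by apply/eqP; apply: contrapT => /negP h; apply: nox; exists x.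
  (* The two halves of [D] contribute the same mean, by invariance of [e] and of the
     mean under translation by [p]. *)
  have eD' : conv e D' = fun=> 0.
    apply/funext => x; rewrite /conv.
    have -> : (fun y => e (x * y)%g * D' (y^-1)%g) =
        (fun y => e (x * y)%g * k y - e (x * (y * p))%g * k (y * p)%g).
      by apply/funext => y; rewrite /D' /D invgK mulgA ep; ring.
    rewrite meanB //; [|by cts|by cts].
    by rewrite (mean_mulr cK p (f := fun y => e (x * y)%g * k y)) ?subrr //; cts.
  have eww : conv e (conv w w) = fun=> 0.
    by rewrite -convA // {1}/w -(convA cK (f := e)) // eD' !conv0l.
  move: ew; have := congr1 (fun h => h 1%g) eww; rewrite conv1 => <-.
  suff -> : (fun y => conv w w (y^-1)%g) = conv w w by rewrite ltxx.
  apply/funext => y; rewrite convV //.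
  by have -> : (fun y => w (y^-1)%g) = w by apply/funext.
exists (fun y => e (x * y)%g), n, (fun i y => g i (x * y)%g); split.
- by rewrite mulg1.
- by cts.
- by move=> i; have [cgi _] := eg i; cts.
move=> q; have [c ec] := gspan _ (eigenfunction_mulr cww q ee).
by exists c => y; have := congr1 (fun h => h (x * y)%g) ec; rewrite /= mulgA.
Qed.

End PeterWeyl.

(** * Polynomial functions *)

Section PolynomialFunctions.
Context {R : realType} {G : topologicalGroupType}.
Implicit Types (f g : G -> Cplx R).

(** Spanning families indexed by an arbitrary finite type: sums and products of
    polynomial functions then have the sum and the product of the index types. *)
Lemma polynomial_functionsP f : polynomial_functions R G f <-> Cc R G f /\
  exists (V : set G) (I : finType) (b : I -> G -> Cplx R),
    [/\ open V, V 1%g, forall i, Cc R G (b i) &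
        forall v, V v -> exists c : I -> Cplx R,
          forall x, f (x * v)%g = \sum_i c i * b i x].
Proof.
have [_ [Cc0 CcD CcZ] _ _] := Cc_star_algebra R G.
split=> [[Cf [V [F [oV V1 [[F0 FD FZ] [n [b Fb]]] FC FV]]]]|].
  split=> //; exists V, 'I_n, b; split=> // [i|v /FV].
    apply: FC; rewrite Fb; exists (fun j => (j == i)%:R) => //.
    by rewrite (bigD1 i) //= eqxx scale1r big1 ?addr0 // => j /negbTE ->; rewrite scale0r.
  rewrite Fb => -[c _ cE]; exists c => x.
  by have := congr1 (fun h => h x) cE; rewrite /translate fct_sumE => <-.
case=> Cf [V [I [b [oV V1 Cb Vb]]]]; split=> //.
pose e (i : 'I_#|I|) := b (enum_val i).
exists V, (lin_span e); split=> //.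
- split; last by exists #|I|, e.
  split.
  + by exists (fun=> 0) => //; rewrite big1 // => i _; rewrite scale0r.
  + move=> _ _ [c _ <-] [d _ <-]; exists (fun i => c i + d i) => //.
    by rewrite -big_split; apply: eq_bigr => i _; rewrite scalerDl.
  + move=> a _ [c _ <-]; exists (fun i => a * c i) => //.
    by rewrite scaler_sumr; apply: eq_bigr => i _; rewrite scalerA.
- move=> _ [c _ <-]; elim/big_ind: _ => // i _; apply: CcZ; exact: Cb.
move=> v /Vb [c cE]; exists (fun i => c (enum_val i)) => //.
apply/funext => x; rewrite fct_sumE /translate cE.
by rewrite [RHS](reindex (@enum_val I I)) //=; apply: onW_bij; exact: enum_val_bij.
Qed.

Lemma polynomial_star_subalgebra : star_subalgebra (polynomial_functions R G) (Cc R G).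
Proof.
have [_ [Cc0 CcD CcZ] CcM CcS] := Cc_star_algebra R G.
split.
- by move=> f [].
- split.
  + apply/polynomial_functionsP; split=> //.
    exists setT, 'I_0, (fun=> 0); split=> //; first exact: openT.
    by move=> v _; exists (fun=> 0) => x; rewrite big_ord0.
  + move=> f g /polynomial_functionsP [Cf [V [I [b [oV V1 Cb Vb]]]]].
    move=> /polynomial_functionsP [Cg [W [J [d [oW W1 Cd Wd]]]]].
    apply/polynomial_functionsP; split; first exact: CcD.
    exists (V `&` W), (I + J)%type, (fun k => match k with inl i => b i | inr j => d j end).
    split=> //; [exact: openI | by case |].
    move=> v [/Vb [c cE] /Wd [c' cE']].
    exists (fun k => match k with inl i => c i | inr j => c' j end) => x.
    by rewrite big_sumType /= -cE -cE'.
  + move=> a f /polynomial_functionsP [Cf [V [I [b [oV V1 Cb Vb]]]]].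
    apply/polynomial_functionsP; split; first exact: CcZ.
    exists V, I, b; split=> // v /Vb [c cE].
    exists (fun i => a * c i) => x; rewrite -[LHS]/(a * f (x * v)%g) cE mulr_sumr.
    by apply: eq_bigr => i _; rewrite mulrA.
- move=> f g /polynomial_functionsP [Cf [V [I [b [oV V1 Cb Vb]]]]].
  move=> /polynomial_functionsP [Cg [W [J [d [oW W1 Cd Wd]]]]].
  apply/polynomial_functionsP; split; first exact: CcM.
  exists (V `&` W), (I * J)%type, (fun k => b k.1 * d k.2).
  split=> //; [exact: openI | by move=> k; exact: CcM |].
  move=> v [/Vb [c cE] /Wd [c' cE']].
  exists (fun k => c k.1 * c' k.2) => x.
  rewrite -[LHS]/(f (x * v)%g * g (x * v)%g) cE cE' mulr_suml.
  rewrite -(pair_bigA _ (fun i j => c i * c' j * (b i * d j) x)) /=.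
  apply: eq_bigr => i _; rewrite mulr_sumr; apply: eq_bigr => j _.
  by rewrite -[(b i * d j) x]/(b i x * d j x) mulrACA.
- move=> f /polynomial_functionsP [Cf [V [I [b [oV V1 Cb Vb]]]]].
  apply/polynomial_functionsP; split; first exact: CcS.
  exists V, I, (fun i => star (b i)); split=> //; first by move=> i; exact: CcS.
  move=> v /Vb [c cE]; exists (fun i => (c i)^*) => x.
  by rewrite /star cE rmorph_sum; apply: eq_bigr => i _; rewrite rmorphM.
Qed.

Lemma Cc_intro f (A : set G) : hausdorff_space G -> continuous f -> compact A ->
  (forall p, f p != 0 -> A p) -> Cc R G f.
Proof.
move=> hG cf cA fA; split=> //.
apply: (subclosed_compact (@closed_closure _ _) cA).
have clA : closed A by exact: compact_closed.
by rewrite [X in _ `<=` X](iffLR (closure_id A) clA); apply: closureS => p /fA.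
Qed.

Lemma locally_constant_continuous f (H : set G) : nbhs 1%g H ->
  (forall p h, H h -> f (p * h)%g = f p) -> continuous f.
Proof.
move=> H1 fH p U /nbhs_singleton Up.
have c : continuous (fun q => (p^-1 * q)%g) by cts.
have : nbhs p [set q | H (p^-1 * q)%g] by apply: (c p H); rewrite mulVg.
apply: filterS => q Hq; rewrite -[q](mulVKg p) /= fH //.
Qed.

Section OpenSubgroup.
Context (hG : hausdorff_space G) (H : set G).
Context (sH : subgroup H) (cH : compact H) (oH : open H).

Lemma subgroup1 : H 1%g.
Proof. by have [/set_mem] := sH. Qed.

Lemma subgroupV x : H x -> H (x^-1)%g.
Proof.
move=> Hx; apply/set_mem; apply: (group_closedV sH); exact/mem_set.
Qed.

Lemma subgroupM x y : H x -> H y -> H (x * y)%g.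
Proof.
move=> Hx Hy; apply/set_mem; apply: (group_closedM sH); exact/mem_set.
Qed.

Lemma subgroupMr x y : H y -> H (x * y)%g -> H x.
Proof. by move=> Hy /subgroupM /(_ (subgroupV Hy)); rewrite mulgK. Qed.

Lemma coset_compact x : compact [set p | H (x^-1 * p)%g].
Proof.
have -> : [set p | H (x^-1 * p)%g] = (fun h => x * h)%g @` H.
  apply/seteqP; split=> [p Hp|_ [h Hh <-]] /=; last by rewrite mulKg.
  by exists (x^-1 * p)%g => //; rewrite mulVKg.
apply: continuous_compact => //; apply: continuous_subspaceT; cts.
Qed.

Definition coset_indicator (s : seq G) : G -> Cplx R :=
  fun p => if `[< exists2 x, x \in s & H (x^-1 * p)%g >] then 1 else 0.

Lemma coset_indicator1 s p x : x \in s -> H (x^-1 * p)%g -> coset_indicator s p = 1.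
Proof. by move=> xs Hp; rewrite /coset_indicator asboolT //; exists x. Qed.

Lemma polynomial_coset_indicator s : polynomial_functions R G (coset_indicator s).
Proof.
have inv p h : H h -> coset_indicator s (p * h)%g = coset_indicator s p.
  move=> Hh; rewrite /coset_indicator; congr (if _ then _ else _).
  apply: asbool_equiv_eq; split=> -[x xs Hx]; exists x => //.
    by move: Hx; rewrite mulgA; exact: subgroupMr.
  by rewrite mulgA; exact: subgroupM.
have nH : nbhs 1%g H by apply: open_nbhs_nbhs; split=> //; exact: subgroup1.
have Cind : Cc R G (coset_indicator s).
  apply: (Cc_intro (A := \big[setU/set0]_(x <- s) [set p | H (x^-1 * p)%g])) => //.
  - exact: (locally_constant_continuous nH).
  - by apply: bigsetU_compact => x _; exact: coset_compact.
  move=> p; rewrite /coset_indicator; case: asboolP => [[x xs Hx] _|]; last by rewrite eqxx.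
  by rewrite -bigcup_seq; exists x.
apply/polynomial_functionsP; split=> //.
exists H, unit, (fun=> coset_indicator s); split=> //; first exact: subgroup1.
by move=> v Hv; exists (fun=> 1) => x; rewrite big_const card_unit /= addr0 mul1r inv.
Qed.

Lemma polynomial_eq1_on_compact (C : set G) : compact C ->
  exists2 f, polynomial_functions R G f & forall p, C p -> f p = 1.
Proof.
move=> cC; have [] := @compact_cover_seq G G C (fun x p => H (x^-1 * p)%g) cC.
  move=> x _; exists x.
  have c : continuous (fun q => (x^-1 * q)%g) by cts.
  apply: (c x H); rewrite mulVg.
  by apply: open_nbhs_nbhs; split=> //; exact: subgroup1.
move=> s sP; exists (coset_indicator s); first exact: polynomial_coset_indicator.
by move=> p /sP [x xs Hx]; exact: (coset_indicator1 xs).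
Qed.

(** A polynomial function that is 1 on the closed supports is a unit. *)
Lemma polynomial_local_units : local_units_in (Cc R G) (polynomial_functions R G).
Proof.
move=> n b Cb.
have [|u Pu u1] := @polynomial_eq1_on_compact
  (\big[setU/set0]_(i < n) closure [set p | b i p != 0]).
  by apply: bigsetU_compact => i _; case: (Cb i).
exists u => // i.
suff ub : u * b i = b i by split=> //; rewrite mulrC.
apply/funext => p; rewrite -[LHS]/(u p * b i p).
have [->|bp] := eqVneq (b i p) 0; first exact: mulr0.
rewrite u1 ?mul1r // -bigcup_seq.
by exists i; [exact: mem_index_enum | exact: subset_closure].
Qed.

Lemma polynomial_nondegenerate : nondegenerate_product (polynomial_functions R G).
Proof.
have unit a : polynomial_functions R G a ->
    exists2 u, polynomial_functions R G u & u * a = a /\ a * u = a.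
  move=> [Ca _]; have [u Pu uE] := @polynomial_local_units 1%N (fun=> a) (fun=> Ca).
  by exists u => //; exact: (uE ord0).
split=> a Pa az; have [u Pu [ua au]] := unit a Pa.
  by rewrite -au az.
by rewrite -ua az.
Qed.

Local Notation K := (subgroup_type sH).

Lemma subgroup_typeP (x : G) : H x -> exists u : K, val u = x.
Proof. by move=> Hx; exists (Sub x (mem_set Hx)); rewrite SubK. Qed.

Definition extend (f : K -> R) : G -> Cplx R :=
  fun x => if insub x is Some u then real_complex R (f u) else 0.

Lemma extend_in (f : K -> R) (u : K) : extend f (val u) = real_complex R (f u).
Proof. by rewrite /extend valK. Qed.

Lemma extend_out (f : K -> R) (x : G) : ~ H x -> extend f x = 0.
Proof. by move=> Hx; rewrite /extend insubN //; apply/negP => /set_mem. Qed.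

Lemma cts_real_complex (X : topologicalType) (f : X -> R) : continuous f ->
  continuous (fun x => real_complex R (f x) : Cplx R).
Proof.
move=> cf x; apply/cvgrPdist_lt => e; rewrite ltcE /= => /andP[/eqP e0 e1].
have /cvgrPdist_lt /(_ _ e1) := cf x; apply: filterS => y.
rewrite -rmorphB normc_def /= expr0n /= addr0 sqrtr_sqr.
by rewrite ltcE /= e0 eqxx.
Qed.

Lemma cts_extend (f : K -> R) : continuous f -> continuous (extend f).
Proof.
move=> cf g; have [Hg|Hg] := pselect (H g).
  have [u ug] := subgroup_typeP Hg.
  rewrite -ug => U; rewrite extend_in => /(cts_real_complex cf) [_ [[W oW <-] Wu WU]].
  have : nbhs (val u) (W `&` H).
    by apply: open_nbhs_nbhs; split; [exact: openI | split=> //; rewrite ug].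
  apply: filterS => p [Wp Hp].
  have [w wp] := subgroup_typeP Hp.
  by move: Wp; rewrite -wp /= extend_in => Ww; exact: WU.
move=> U; rewrite (extend_out _ Hg) => /nbhs_singleton U0.
have : nbhs g (~` H).
  by apply: open_nbhs_nbhs; split=> //; apply: closed_openC; exact: compact_closed.
by apply: filterS => p Hp; rewrite /= extend_out.
Qed.

(** Right translation by an element of [H] preserves the coset [xH] and its
    complement, so the translation formula on [H] persists after extension by zero. *)
Lemma polynomial_extend (f : K -> R) n (b : nat -> K -> R) x :
  continuous f -> (forall i, continuous (b i)) ->
  (forall q, exists c : nat -> R, forall y, f (y * q)%g = \sum_(i < n) c i * b i y) ->
  polynomial_functions R G (fun p => extend f (x^-1 * p)%g).
Proof.
move=> cf cb fq.
have Cext (h : K -> R) : continuous h -> Cc R G (fun p => extend h (x^-1 * p)%g).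
  move=> ch; have cx : continuous (fun p => x^-1 * p)%g by cts.
  have cext : continuous (fun p => extend h (x^-1 * p)%g).
    exact: (@cts_comp _ _ _ (extend h) _ (cts_extend ch) cx).
  have supp p : extend h (x^-1 * p)%g != 0 -> H (x^-1 * p)%g.
    by move=> /eqP hp; apply: contrapT => /(extend_out h).
  exact: (Cc_intro hG cext (@coset_compact x) supp).
apply/polynomial_functionsP; split; first exact: Cext.
exists H, 'I_n, (fun (i : 'I_n) p => extend (b i) (x^-1 * p)%g); split.
- exact: oH.
- exact: subgroup1.
- by move=> i; exact: Cext.
move=> v Hv.
have [q qv] := subgroup_typeP Hv.
have [c cE] := fq q; exists (fun i : 'I_n => real_complex R (c i)) => p; rewrite mulgA.
have [Hp|Hp] := pselect (H (x^-1 * p)%g).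
  have [u up] := subgroup_typeP Hp.
  rewrite -up -qv -[(val u * val q)%g]/(val (u * q)%g) extend_in cE rmorph_sum.
  by apply: eq_bigr => i _; rewrite extend_in rmorphM.
rewrite extend_out; last by move=> Hpv; apply: Hp; exact: (subgroupMr Hv Hpv).
by rewrite big1 // => i _; rewrite extend_out // mulr0.
Qed.

Lemma polynomial_separates : separates_points (polynomial_functions R G).
Proof.
move=> p q pq; have [Hpq|Hpq] := pselect (H (p^-1 * q)%g); last first.
  exists (coset_indicator [:: p]); first exact: polynomial_coset_indicator.
  rewrite (coset_indicator1 (mem_head _ _)); last by rewrite mulVg; exact: subgroup1.
  rewrite /coset_indicator asboolF; first by move/eqP; rewrite oner_eq0.
  by case=> x; rewrite inE => /eqP ->.
have [h hE] := subgroup_typeP Hpq.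
have h1 : 1%g <> h.
  move=> h1; apply: pq; have : (p^-1 * q)%g = 1%g by rewrite -hE -h1.
  by move/(congr1 (fun x => p * x)%g); rewrite mulVKg mulg1.
have cK : compact [set: K] by exact: subgroup_compact.
have hK : hausdorff_space K by exact: subgroup_hausdorff.
have aK := hausdorff_accessible hK.
have := @normal_completely_regular R K (compact_normal hK cK) aK 1%g [set h].
move=> /(_ (@accessible_closed_set1 K aK h) h1) /(@uniform_separatorP _ R) [k [ck _ k1 kh]].
have kne : k h != k 1%g.
  have -> : k h = 1 by apply: kh; exists h.
  have -> : k 1%g = 0 by apply: k1; exists 1%g.
  exact: oner_neq0.
have [f [n [b [fne cf cb fq]]]] := exists_representative_function cK ck kne.
exists (fun x => extend f (p^-1 * x)%g); first exact: (polynomial_extend _ cf cb fq).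
rewrite mulVg -hE extend_in -[1%g]/(val (1%g : K)) extend_in => /complexI /eqP.
by rewrite eq_sym (negbTE fne).
Qed.

End OpenSubgroup.
End PolynomialFunctions.

Unset Implicit Arguments.

Theorem proposition5p14 (R : realType) (G : topologicalGroupType)
    (lcG : locally_compact_group G)
    (coG : has_compact_open_subgroup G) :
  [/\ star_subalgebra (polynomial_functions R G) (Cc R G) /\
        nondegenerate_product (polynomial_functions R G),
      separates_points (polynomial_functions R G),
      (forall C : set G, compact C ->
         exists2 f, polynomial_functions R G f & forall p, C p -> f p = 1),
      local_units_in (Cc R G) (polynomial_functions R G)
    & nondegenerate_product (polynomial_functions R G)].
Proof.
have [hG _] := lcG; have [H [sH cH oH]] := coG.
have nd := polynomial_nondegenerate (R := R) hG sH cH oH.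
split=> //.
- by split=> //; exact: polynomial_star_subalgebra.
- exact: (polynomial_separates hG sH cH oH).
- exact: (polynomial_eq1_on_compact hG sH cH oH).
- exact: (polynomial_local_units hG sH cH oH).
Qed.
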